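(* Assume $N+1>d$. The sample covariances $p_n,\widehat p_n$ of the Ensemble Kalman filter are positive definite with probability $1$, and $p_0\to\widehat p_0\to p_1\to\widehat p_1\to\cdots$ is a Markov chain given by the initial condition $$p_0\sim \frac1N\,\mathrm{Wishart}_d(N,0,P_0)$$ and for any $n\ge0$ by the updating-prediction transitions (conditional laws given $p_n$, respectively given $\widehat p_n$) $$\widehat p_n\sim\frac1N\,\mathrm{Wishart}_d\left(N,\,N\,\widehat A(p_n)p_n\widehat A(p_n)',\,\widehat R(p_n)\right),\qquad p_{n+1}\sim\frac1N\,\mathrm{Wishart}_d\left(N,\,N\,A\widehat p_nA',\,R\right).$$
   Context: $M'$ is the transpose, $I$ the identity matrix. Non-central Wishart law: for $z\in\mathbb{R}^{d\times N}$ and positive semi-definite $\Sigma\in\mathbb{R}^{d\times d}$, $\mathrm{Wishart}_d(N,zz',\Sigma)$ is the law of $(z+Z)(z+Z)'$, where $Z$ is a $d\times N$ random matrix with independent $\mathcal N_d(0,\Sigma)$ columns (this law depends on $z$ only through $zz'$). $\frac1N\mathrm{Wishart}_d(\cdot)$ is the law of $M/N$ with $M\sim\mathrm{Wishart}_d(\cdot)$. Model. Fix $d,d_0\ge1$, $A\in\mathbb{R}^{d\times d}$, $B\in\mathbb{R}^{d_0\times d}$, and symmetric positive definite $R\in\mathbb{R}^{d\times d}$, $R_0\in\mathbb{R}^{d_0\times d_0}$, $P_0\in\mathbb{R}^{d\times d}$. The signal-observation process is $X_{n+1}=AX_n+W_n$, $Y_n=BX_n+V_n$, $n\ge0$, where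 $W_n\sim\mathcal N(0,R)$, $V_n\sim\mathcal N(0,R_0)$ are independent sequences of independent variables, independent of the Gaussian variable $X_0$ which has covariance $P_0$. For positive semi-definite $P$ set $K(P):=PB'(BPB'+R_0)^{-1}$, $\widehat A(P):=I-K(P)B$, $\widehat R(P):=K(P)R_0K(P)'$. Ensemble Kalman filter. Let $\xi_0^i$, $1\le i\le N+1$, be independent copies of $X_0$ and let $\mathcal W_n^i\sim\mathcal N(0,R)$, $\mathcal V^i_n\sim\mathcal N(0,R_0)$ be independent, all independent of each other and of $(X_n,Y_n)_{n\ge0}$. Define for $n\ge 0$, $1\le i\le N+1$ $$\widehat\xi_n^i=\xi_n^i+K(p_n)\big(Y_n-(B\xi_n^i+\mathcal V_n^i)\big),\qquad \xi_{n+1}^i=A\widehat\xi_n^i+\mathcal W_{n+1}^i,$$ where $m_n=\frac1{N+1}\sum_i\xi_n^i$, $p_n=\frac1N\sum_{i}(\xi_n^i-m_n)(\xi_n^i-m_n)'$, $\widehat m_n=\frac1{N+1}\sum_i\widehat\xi_n^i$, $\widehat p_n=\frac1N\sum_{i}(\widehat\xi_n^i-\widehat m_n)(\widehat\xi_n^i-\widehat m_n)'$, sums over $1\le i\le N+1$. *)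

(* Defs.v *)
From HB Require Import structures.
From mathcomp Require Import all_boot all_order all_algebra.
From mathcomp Require Import all_classical all_reals all_analysis.

Set Implicit Arguments.
Unset Strict Implicit.
Unset Printing Implicit Defensive.

Import Order.TTheory GRing.Theory Num.Theory.
Import numFieldNormedType.Exports.

Local Open Scope classical_set_scope.
Local Open Scope ring_scope.

(* Real matrices carry the sigma-algebra generated by the entries, which is
   the Borel sigma-algebra; this mirrors the library instance on tuples. *)
Definition measure_matrix_display : measure_display -> measure_display.
Proof. exact. Qed.

Section measurable_matrix.
Variables (R : realType) (m n : nat).

Definition g_sigma_entries : set (set 'M[R]_(m, n)) :=
  <<s \bigcup_(ij in [set: 'I_m * 'I_n])
        preimage_set_system setT (fun M : 'M[R]_(m, n) => M ij.1 ij.2)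
          measurable >>.

Let entries_set0 : g_sigma_entries set0.
Proof. exact: sigma_algebra0. Qed.

Let entries_setC C : g_sigma_entries C -> g_sigma_entries (~` C).
Proof. exact: sigma_algebraC. Qed.

Let entries_bigcup (F : (set 'M[R]_(m, n))^nat) :
  (forall i, g_sigma_entries (F i)) -> g_sigma_entries (\bigcup_i F i).
Proof. exact: sigma_algebra_bigcup. Qed.

HB.instance Definition _ :=
  @isMeasurable.Build (measure_matrix_display default_measure_display)
    'M[R]_(m, n) g_sigma_entries entries_set0 entries_setC entries_bigcup.

End measurable_matrix.

Section definiteness.
Variables (R : realType) (d : nat).

Definition posdefmx (M : 'M[R]_d) : Prop :=
  M^T = M /\ forall u : 'cV[R]_d, u != 0 -> 0 < (u^T *m M *m u) 0 0.

Definition possemidefmx (M : 'M[R]_d) : Prop :=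
  M^T = M /\ forall u : 'cV[R]_d, 0 <= (u^T *m M *m u) 0 0.

End definiteness.

Section independence_and_markov.
Context {disp : measure_display} {T : measurableType disp} {R : realType}.
Variable P : probability T R.

(* Product rule over every finite subfamily, a subfamily being enumerated
   without repetition by an injective [f]. *)
Definition mutually_independent (I : Type) (F : I -> set (set T)) : Prop :=
  forall (k : nat) (f : 'I_k -> I) (E : 'I_k -> set T),
    injective f -> (forall i, F (f i) (E i)) ->
    P (\bigcap_i E i) = (\prod_(i < k) P (E i))%E.

Context {disp' : measure_display} {S : measurableType disp'}.

Definition history (Z : nat -> T -> S) (k : nat) : set (set T) :=
  <<s \bigcup_(j in `I_k.+1) g_sigma_algebra_preimage (Z j) >>.

(* Given Z_0, ..., Z_k, the conditional law of Z_(k+1) is kappa_k(Z_k): this is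
   the Markov property together with the values of the transition kernels. *)
Definition markov_chain (Z : nat -> T -> S) (kappa : nat -> R.-pker S ~> S) :
    Prop :=
  (forall k, measurable_fun setT (Z k)) /\
  (forall (k : nat) (D : set T) (C : set S), history Z k D -> measurable C ->
    P (D `&` Z k.+1 @^-1` C) = (\int[P]_(w in D) kappa k (Z k w) C)%E).

End independence_and_markov.

Section laws.
Variable R : realType.

(* N_d(m, Sigma) is the law of m + L G, where L L' = Sigma and G has independent
   standard normal entries; Sigma may be singular. Laws are compared on
   measurable sets only, a measure having arbitrary values elsewhere. *)
Definition gaussian_law (d : nat) (m : 'cV[R]_d) (Sigma : 'M[R]_d)
    (mu : set 'cV[R]_d -> \bar R) : Prop :=
  exists (k : nat) (L : 'M[R]_(d, k))
         (disp : measure_display) (T : measurableType disp)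
         (Q : probability T R) (G : {RV Q >-> 'cV[R]_k}),
    [/\ L *m L^T = Sigma,
        mutually_independent Q
          (fun i => g_sigma_algebra_preimage (fun w => G w i 0)),
        forall (i : 'I_k) (C : set R), measurable C ->
          Q [set w | C (G w i 0)] = normal_prob 0 1 C &
        forall C, measurable C -> mu C = Q [set w | C (m + L *m G w)]].

(* [wishart_law N S Sigma mu]: mu is Wishart_d(N, S, Sigma), with S = z z'. *)
Definition wishart_law (d N : nat) (S Sigma : 'M[R]_d)
    (mu : set 'M[R]_d -> \bar R) : Prop :=
  exists (z : 'M[R]_(d, N))
         (disp : measure_display) (T : measurableType disp)
         (Q : probability T R) (Z : {RV Q >-> 'M[R]_(d, N)}),
    [/\ z *m z^T = S,
        mutually_independent Q
          (fun j => g_sigma_algebra_preimage (fun w => col j (Z w))),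
        forall j, gaussian_law 0 Sigma (pushforward Q (fun w => col j (Z w))) &
        forall C, measurable C ->
          mu C = Q [set w | C ((z + Z w) *m (z + Z w)^T)]].

(* (1/N) Wishart_d(N, S, Sigma) *)
Definition scaled_wishart_law (d N : nat) (S Sigma : 'M[R]_d)
    (mu : set 'M[R]_d -> \bar R) : Prop :=
  exists2 nu : probability 'M[R]_d R, wishart_law N S Sigma nu &
    forall C, measurable C -> mu C = nu [set M | C (N%:R^-1 *: M)].

End laws.

(* The filters are defined path by path: the driving noises enter as
   deterministic sequences, to be evaluated at a sample point. *)
Section ensemble_kalman_filter.
Variables (R : realType) (d d0 : nat).
Variables (A : 'M[R]_d) (B : 'M[R]_(d0, d)) (R0 : 'M[R]_d0).

Definition gain (P : 'M[R]_d) : 'M[R]_(d, d0) :=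
  P *m B^T *m invmx (B *m P *m B^T + R0).

Definition Ahat (P : 'M[R]_d) : 'M[R]_d := 1%:M - gain P *m B.

Definition Rhat (P : 'M[R]_d) : 'M[R]_d := gain P *m R0 *m (gain P)^T.

Fixpoint signal (x0 : 'cV[R]_d) (w : nat -> 'cV[R]_d) (n : nat) : 'cV[R]_d :=
  if n is k.+1 then A *m signal x0 w k + w k else x0.

Definition observation (x0 : 'cV[R]_d) (w : nat -> 'cV[R]_d)
    (v : nat -> 'cV[R]_d0) (n : nat) : 'cV[R]_d0 :=
  B *m signal x0 w n + v n.

Variable N : nat.

Definition ensemble := 'I_N.+1 -> 'cV[R]_d.

Definition sample_mean (x : ensemble) : 'cV[R]_d :=
  N.+1%:R^-1 *: \sum_i x i.

Definition sample_cov (x : ensemble) : 'M[R]_d :=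
  N%:R^-1 *: \sum_i (x i - sample_mean x) *m (x i - sample_mean x)^T.

Definition enkf_update (y : 'cV[R]_d0) (v : 'I_N.+1 -> 'cV[R]_d0)
    (x : ensemble) : ensemble :=
  fun i => x i + gain (sample_cov x) *m (y - (B *m x i + v i)).

Variables (y : nat -> 'cV[R]_d0) (x0 : ensemble) (w : nat -> ensemble)
          (v : nat -> 'I_N.+1 -> 'cV[R]_d0).

Fixpoint enkf (n : nat) : ensemble :=
  if n is k.+1
  then fun i => A *m enkf_update (y k) (v k) (enkf k) i + w k.+1 i
  else x0.

Definition enkf_hat (n : nat) : ensemble := enkf_update (y n) (v n) (enkf n).

End ensemble_kalman_filter.

Inductive noise_index (N : nat) : Type :=
| SignalInit
| SignalNoise of nat
| SensorNoise of nat
| ParticleInit of 'I_N.+1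
| ParticleSignalNoise of nat & 'I_N.+1
| ParticleSensorNoise of nat & 'I_N.+1.

Section noise.
Context {disp : measure_display} {T : measurableType disp} {R : realType}.
Variables (d d0 N : nat).
Variables (X0 : T -> 'cV[R]_d) (W : nat -> T -> 'cV[R]_d)
  (V : nat -> T -> 'cV[R]_d0) (xi0 : 'I_N.+1 -> T -> 'cV[R]_d)
  (cW : nat -> 'I_N.+1 -> T -> 'cV[R]_d)
  (cV : nat -> 'I_N.+1 -> T -> 'cV[R]_d0).

Definition noise_sigma (a : noise_index N) : set (set T) :=
  match a with
  | SignalInit => g_sigma_algebra_preimage X0
  | SignalNoise n => g_sigma_algebra_preimage (W n)
  | SensorNoise n => g_sigma_algebra_preimage (V n)
  | ParticleInit i => g_sigma_algebra_preimage (xi0 i)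
  | ParticleSignalNoise n i => g_sigma_algebra_preimage (cW n i)
  | ParticleSensorNoise n i => g_sigma_algebra_preimage (cV n i)
  end.

End noise.

(* p_0, phat_0, p_1, phat_1, ... is [alternate p phat]. *)
Definition alternate (U : Type) (a b : nat -> U) (k : nat) : U :=
  if odd k then b k./2 else a k./2.

(* Main.v *)
Require Import Defs.
From HB Require Import structures.
From mathcomp Require Import all_boot all_order all_algebra.
From mathcomp Require Import all_classical all_reals all_analysis.
From mathcomp Require Import measurable_realfun.
From mathcomp Require Import ring lra.

(** Rotation invariance of Gaussian matrices carries the whole proof. A matrix with
    independent standard normal entries keeps its law under right multiplication by
    a rotation ([gauss_invariant]); rotations of a plane are products of shears,
    which preserve area, and general rotations are assembled from planar ones.

    Two ensembles of row vectors with the same Gram matrix differ by such a rotation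
    ([gram_orbit]). Hence the law of [L *m G] depends on [L *m L^T] only
    ([gauss_mulmx_law]), so that all Gaussian laws of the model can be sampled with
    one factor per covariance, and the law of [(z + L *m G) *m (z + L *m G)^T]
    depends on [z] only through [z *m z^T] ([gauss_gram_orbit]).

    Rotating the all-ones row to an axis gives a matrix [U] of contrasts
    ([helmert_exists]): it kills the constants, [U *m U^T] is the centering
    projection, and [G *m U] is Gaussian when [G] is. The sample covariance of an
    ensemble [X] is therefore the Gram matrix of [X *m U], divided by [N]. In these
    coordinates the observations, which are common to all particles, disappear: the
    contrasts follow the autonomous recursion
    [S' = Ahat p *m S - gain p *m V *m U] and [S'' = A *m S' + W *m U], where [p] is
    the Gram matrix of [S] divided by [N], and [V *m U] and [W *m U] are Gaussian
    matrices independent of the past ([contrast_updateE], [contrast_predictE],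
    [fresh_noise_step]).

    Freezing the past ([past_freeze]) gives the conditional law of the next sample
    covariance as a Wishart law whose non-centrality is, for instance,
    [(Ahat p *m S) *m (Ahat p *m S)^T], that is [N] times [Ahat p *m p *m (Ahat p)^T].
    It is a function of the current sample covariance alone, whence the Markov
    property. A measurable Cholesky factor ([cholesky_gram]) turns the family of
    these laws into a kernel.

    Positive definiteness: the determinant of a Gram matrix is a polynomial in the
    Gaussian entries, and a polynomial which is not identically zero vanishes with
    probability [0] ([gauss_nonvanishing]). The noises of definite covariance can
    bring the contrasts to full row rank, and the update preserves it at the value
    zero of its noise because [Ahat p] is invertible ([Ahat_unit]). *)

Set Implicit Arguments.
Unset Strict Implicit.
Unset Printing Implicit Defensive.

Import Order.TTheory GRing.Theory Num.Theory.
Import numFieldNormedType.Exports.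

Local Open Scope classical_set_scope.
Local Open Scope ring_scope.

(** * Measurability of matrix-valued maps *)

Lemma measurable_preimageT d d' (T : measurableType d) (T' : measurableType d')
    (f : T -> T') (A : set T') :
  measurable_fun setT f -> measurable A -> measurable (f @^-1` A).
Proof. by move=> mf mA; rewrite -[X in measurable X]setTI; exact: mf. Qed.

Section matrix_measurability.
Context {R : realType}.

Lemma measurable_mx_entry m n (i : 'I_m) (j : 'I_n) :
  measurable_fun [set: 'M[R]_(m, n)] (fun M : 'M[R]_(m, n) => M i j).
Proof.
move=> _ C mC; rewrite setTI.
apply: sub_sigma_algebra; exists (i, j) => //.
by exists C => //; rewrite setTI.
Qed.

Lemma measurable_fun_mxP d (T : measurableType d) m n (f : T -> 'M[R]_(m, n)) :
  measurable_fun [set: T] f <->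
  forall i j, measurable_fun [set: T] (fun w => f w i j).
Proof.
split=> [mf i j|mf].
  exact: (measurableT_comp (measurable_mx_entry i j) mf).
apply: (@measurability _ _ _ _ _ _ (\bigcup_(ij in [set: 'I_m * 'I_n])
        preimage_set_system setT (fun M : 'M[R]_(m, n) => M ij.1 ij.2)
          measurable)) => //.
move=> _ [_ [[i j] _ [C mC <-]] <-]; rewrite !setTI.
by rewrite -[X in measurable X]setTI; exact: mf.
Qed.

Lemma measurable_mulmxl k m n (O : 'M[R]_(m, n)) :
  measurable_fun setT (fun M : 'M[R]_(k, m) => M *m O).
Proof.
apply/measurable_fun_mxP => i j; under eq_fun do rewrite mxE.
apply: measurable_sum => l; apply: measurable_funM; last exact: measurable_cst.
exact: measurable_mx_entry.
Qed.

Lemma measurable_mulmxr k m n (O : 'M[R]_(k, m)) :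
  measurable_fun setT (fun M : 'M[R]_(m, n) => O *m M).
Proof.
apply/measurable_fun_mxP => i j; under eq_fun do rewrite mxE.
apply: measurable_sum => l; apply: measurable_funM; first exact: measurable_cst.
exact: measurable_mx_entry.
Qed.

Section operations.
Context {d : measure_display} {T : measurableType d}.
Implicit Types m n p : nat.

Lemma measurable_fun_mxD m n (f g : T -> 'M[R]_(m, n)) :
  measurable_fun setT f -> measurable_fun setT g ->
  measurable_fun setT (fun w => f w + g w).
Proof.
move=> /measurable_fun_mxP mf /measurable_fun_mxP mg.
apply/measurable_fun_mxP => i j; under eq_fun do rewrite mxE.
exact: measurable_funD.
Qed.

Lemma measurable_fun_mxN m n (f : T -> 'M[R]_(m, n)) :
  measurable_fun setT f -> measurable_fun setT (fun w => - f w).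
Proof.
move=> /measurable_fun_mxP mf.
apply/measurable_fun_mxP => i j; under eq_fun do rewrite mxE.
exact: measurableT_comp.
Qed.

Lemma measurable_fun_mxB m n (f g : T -> 'M[R]_(m, n)) :
  measurable_fun setT f -> measurable_fun setT g ->
  measurable_fun setT (fun w => f w - g w).
Proof.
by move=> mf mg; apply: measurable_fun_mxD => //; exact: measurable_fun_mxN.
Qed.

Lemma measurable_fun_mulmx m n p (f : T -> 'M[R]_(m, n)) (g : T -> 'M[R]_(n, p)) :
  measurable_fun setT f -> measurable_fun setT g ->
  measurable_fun setT (fun w => f w *m g w).
Proof.
move=> /measurable_fun_mxP mf /measurable_fun_mxP mg.
apply/measurable_fun_mxP => i j; under eq_fun do rewrite mxE.
by apply: measurable_sum => k; exact: measurable_funM.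
Qed.

Lemma measurable_fun_scalemx m n (a : T -> R) (f : T -> 'M[R]_(m, n)) :
  measurable_fun setT a -> measurable_fun setT f ->
  measurable_fun setT (fun w => a w *: f w).
Proof.
move=> ma /measurable_fun_mxP mf.
apply/measurable_fun_mxP => i j; under eq_fun do rewrite mxE.
exact: measurable_funM.
Qed.

Lemma measurable_fun_trmx m n (f : T -> 'M[R]_(m, n)) :
  measurable_fun setT f -> measurable_fun setT (fun w => (f w)^T).
Proof.
move=> /measurable_fun_mxP mf.
apply/measurable_fun_mxP => i j; under eq_fun do rewrite mxE.
exact: mf.
Qed.

Lemma measurable_fun_col m n (j : 'I_n) (f : T -> 'M[R]_(m, n)) :
  measurable_fun setT f -> measurable_fun setT (fun w => col j (f w)).
Proof.
move=> /measurable_fun_mxP mf.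
apply/measurable_fun_mxP => i k; under eq_fun do rewrite mxE.
exact: mf.
Qed.

Lemma measurable_fun_rsubmx m n1 n2 (f : T -> 'M[R]_(m, n1 + n2)) :
  measurable_fun setT f -> measurable_fun setT (fun w => rsubmx (f w)).
Proof.
move=> /measurable_fun_mxP mf.
apply/measurable_fun_mxP => i k; under eq_fun do rewrite mxE.
exact: mf.
Qed.

Lemma measurable_fun_dlsubmx m1 m2 n1 n2 (f : T -> 'M[R]_(m1 + m2, n1 + n2)) :
  measurable_fun setT f -> measurable_fun setT (fun w => dlsubmx (f w)).
Proof.
move=> /measurable_fun_mxP mf; apply/measurable_fun_mxP => i k.
under eq_fun do rewrite !mxE.
exact: mf.
Qed.

Lemma measurable_fun_drsubmx m1 m2 n1 n2 (f : T -> 'M[R]_(m1 + m2, n1 + n2)) :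
  measurable_fun setT f -> measurable_fun setT (fun w => drsubmx (f w)).
Proof.
move=> /measurable_fun_mxP mf; apply/measurable_fun_mxP => i k.
under eq_fun do rewrite !mxE.
exact: mf.
Qed.

Lemma measurable_fun_row_mx m n1 n2 (f : T -> 'M[R]_(m, n1))
    (g : T -> 'M[R]_(m, n2)) :
  measurable_fun setT f -> measurable_fun setT g ->
  measurable_fun setT (fun w => row_mx (f w) (g w)).
Proof.
move=> /measurable_fun_mxP mf /measurable_fun_mxP mg.
apply/measurable_fun_mxP => i j; case: (split_ordP j) => k ->.
  under eq_fun do rewrite row_mxEl.
  exact: mf.
under eq_fun do rewrite row_mxEr.
exact: mg.
Qed.

Lemma measurable_fun_col_mx m1 m2 n (f : T -> 'M[R]_(m1, n))
    (g : T -> 'M[R]_(m2, n)) :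
  measurable_fun setT f -> measurable_fun setT g ->
  measurable_fun setT (fun w => col_mx (f w) (g w)).
Proof.
move=> /measurable_fun_mxP mf /measurable_fun_mxP mg.
apply/measurable_fun_mxP => i j; case: (split_ordP i) => k ->.
  under eq_fun do rewrite col_mxEu.
  exact: mf.
under eq_fun do rewrite col_mxEd.
exact: mg.
Qed.

Lemma measurable_fun_scalar_mx n (a : T -> R) :
  measurable_fun setT a -> measurable_fun setT (fun w => (a w)%:M : 'M[R]_n).
Proof.
move=> ma; apply/measurable_fun_mxP => i j; under eq_fun do rewrite mxE.
case: (i == j) => //.
exact: measurable_cst.
Qed.

Lemma measurable_fun_det n (f : T -> 'M[R]_n) :
  measurable_fun setT f -> measurable_fun setT (fun w => \det (f w)).
Proof.
move=> /measurable_fun_mxP mf; rewrite /determinant.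
apply: measurable_sum => s; apply: measurable_funM => //.
exact: measurable_prod.
Qed.

(** [x^-1 = x * (x ^ 2)^-1] holds at [0] too, and [(x ^ 2)^-1] is a real power
    of a nonnegative number. *)
Lemma measurable_funV (f : T -> R) :
  measurable_fun setT f -> measurable_fun setT (fun w => (f w)^-1).
Proof.
move=> mf.
have -> : (fun w => (f w)^-1) = (fun w => f w * powR (f w ^+ 2) (-1)).
  apply/funext => w; have [->|f0] := eqVneq (f w) 0; first by rewrite invr0 mul0r.
  by rewrite powR_inv1 ?sqr_ge0// expr2 invfM mulrA divff// mul1r.
apply: measurable_funM => //; apply: (measurableT_comp (measurable_powR _)).
exact: measurable_funX.
Qed.

Lemma measurable_fun_sqrt (f : T -> R) :
  measurable_fun setT f -> measurable_fun setT (fun w => Num.sqrt (f w)).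
Proof.
move=> mf.
have -> : (fun w => Num.sqrt (f w)) = (fun w => powR (Num.max (f w) 0) 2^-1).
  apply/funext => w; rewrite powR12_sqrt ?le_max ?lexx ?orbT//.
  by have [f0|/ltW f0] := lerP (f w) 0; [rewrite sqrtr0 ler0_sqrtr|].
apply: (measurableT_comp (measurable_powR _)).
by apply: measurable_maxr => //; exact: measurable_cst.
Qed.

Lemma measurable_fun_adjmx n (f : T -> 'M[R]_n) :
  measurable_fun setT f -> measurable_fun setT (fun w => \adj (f w)).
Proof.
move=> mf; apply/measurable_fun_mxP => i j; under eq_fun do rewrite mxE.
apply: measurable_funM => //; apply: measurable_fun_det.
apply/measurable_fun_mxP => k l; under eq_fun do rewrite !mxE.
exact: (proj1 (measurable_fun_mxP f) mf).
Qed.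

Lemma measurable_fun_invmx n (f : T -> 'M[R]_n) :
  measurable_fun setT f -> measurable_fun setT (fun w => invmx (f w)).
Proof.
move=> mf.
have -> : (fun w => invmx (f w)) =
    (fun w => if \det (f w) == 0 then f w else (\det (f w))^-1 *: \adj (f w)).
  apply/funext => w; rewrite /invmx unitmxE unitfE.
  by case: (_ == 0).
apply: measurable_fun_ifT => //.
- by apply: measurable_fun_eqr => //; exact: measurable_fun_det.
- apply: measurable_fun_scalemx; last exact: measurable_fun_adjmx.
  exact/measurable_funV/measurable_fun_det.
Qed.

End operations.
End matrix_measurability.

(** * Standard Gaussian matrices *)

Section measure_on_matrices.
Context {R : realType}.
Implicit Types m n : nat.

Lemma measurable_entry_rectangle m n (C : 'I_m -> 'I_n -> set R) :
  (forall i j, measurable (C i j)) ->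
  measurable [set M : 'M[R]_(m, n) | forall i j, C i j (M i j)].
Proof.
move=> mC.
rewrite [X in measurable X](_ : _ = \bigcap_(ij in [set: 'I_m * 'I_n])
    ((fun M : 'M[R]_(m, n) => M ij.1 ij.2) @^-1` C ij.1 ij.2)).
  apply: fin_bigcap_measurable => // -[i j] _ /=.
  by rewrite -[X in measurable X]setTI; exact: measurable_mx_entry.
apply/seteqP; split=> [M CM [i j] _ /=|M CM i j]; first exact: CM.
exact: (CM (i, j)).
Qed.

(** Entry rectangles are stable under intersection and generate the
    sigma-algebra of matrices. *)
Lemma mx_measure_unique m n (mu nu : {measure set 'M[R]_(m, n) -> \bar R}) :
  (mu setT < +oo)%E ->
  (forall C : 'I_m -> 'I_n -> set R, (forall i j, measurable (C i j)) ->
    mu [set M | forall i j, C i j (M i j)] =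
    nu [set M | forall i j, C i j (M i j)]) ->
  forall A, measurable A -> mu A = nu A.
Proof.
move=> mufin munu A mA.
pose G := [set A : set 'M[R]_(m, n) | exists2 C : 'I_m -> 'I_n -> set R,
   (forall i j, measurable (C i j)) & A = [set M | forall i j, C i j (M i j)]].
have GT : G setT.
  by exists (fun _ _ => setT) => //; apply/seteqP; split.
apply: (measure_unique G (fun=> setT)) => //.
- apply/seteqP; split => [B mB|B].
    have : smallest (sigma_algebra setT) G B; last by [].
    apply: (smallest_sub (C := sigma_algebra setT)) mB.
      exact: smallest_sigma_algebra.
    move=> _ [[i j] _ [C mC <-]]; apply: sub_sigma_algebra.
    exists (fun i' j' => if (i', j') == (i, j) then C else setT) => [i' j'|].
      by case: ifP.
    rewrite setTI; apply/seteqP; split=> [M CM i' j' /=|M CM].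
      by case: eqP => // -[-> ->].
    by have := CM i j; rewrite eqxx.
  apply: smallest_sub; first exact: sigma_algebra_measurable.
  by move=> _ [C mC ->]; exact: measurable_entry_rectangle.
- move=> _ _ [C mC ->] [D mD ->]; exists (fun i j => C i j `&` D i j).
    by move=> i j; exact: measurableI.
  apply/seteqP; split=> [M [CM DM] i j|M CDM]; first by split.
  by split=> i j; case: (CDM i j).
- by apply/seteqP; split=> // x _; exists 0%N.
- by move=> _ [C mC ->]; exact: munu.
Qed.

End measure_on_matrices.

Section image_probability.
Context {d d'} {T : measurableType d} {T' : measurableType d'} {R : realType}.
Variables (P : probability T R) (f : T -> T') (mf : measurable_fun setT f).

Definition random_variable_of : {RV P >-> T'} :=
  HB.pack f (isMeasurableFun.Build _ _ _ _ f mf).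

Definition image_prob : probability T' R := distribution P random_variable_of.

Lemma image_probE A : image_prob A = P (f @^-1` A).
Proof. by []. Qed.

End image_probability.

Lemma row_mx_ord0 (R : realType) k n (M : 'cV[R]_k) (N : 'M[R]_(k, n)) i :
  (row_mx M N : 'M[R]_(k, n.+1)) i ord0 = M i 0.
Proof.
rewrite (_ : ord0 = lshift n (ord0 : 'I_1)); last exact/val_inj.
exact: row_mxEl.
Qed.

Lemma row_mx_lift (R : realType) k n (M : 'cV[R]_k) (N : 'M[R]_(k, n)) i j :
  (row_mx M N : 'M[R]_(k, n.+1)) i (lift ord0 j) = N i j.
Proof.
rewrite (_ : lift ord0 j = rshift 1 j); last exact/val_inj.
exact: row_mxEr.
Qed.

Section standard_gaussian.
Context {R : realType}.
Implicit Types m n : nat.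

Let measurable_toR : measurable_fun setT (idfun : measurableTypeR R -> R).
Proof. exact: measurable_id. Qed.

(** The identity moves the law from the copy of the real line which carries the
    Lebesgue measure to the one over which matrices are measurable. *)
Definition std_normal : probability R R :=
  image_prob (normal_prob 0 1 : probability (measurableTypeR R) R) measurable_toR.

Lemma measurable_row_cons n :
  measurable_fun setT (fun x : R * 'rV[R]_n => row_mx x.1%:M x.2 : 'rV[R]_n.+1).
Proof.
apply: (measurable_fun_row_mx (n1 := 1)); last exact: measurable_snd.
by apply: measurable_fun_scalar_mx; exact: measurable_fst.
Qed.

(** A Gaussian row is built by prepending independent coordinates; this choice
    disappears behind [gauss_unique] below. *)
Fixpoint gauss_row n : probability 'rV[R]_n R :=
  if n is k.+1
  then image_prob (std_normal \x gauss_row k)%E (@measurable_row_cons k)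
  else \d_(0 : 'rV[R]_0).

Lemma gauss_rowS n (A : set 'rV[R]_n.+1) :
  gauss_row n.+1 A = (std_normal \x gauss_row n)%E
    ((fun x : R * 'rV[R]_n => row_mx x.1%:M x.2 : 'rV[R]_n.+1) @^-1` A).
Proof. by []. Qed.

Lemma gauss_row_rectangle n (C : 'I_n -> set R) :
  (forall j, measurable (C j)) ->
  gauss_row n [set x | forall j, C j (x 0 j)] = (\prod_j std_normal (C j))%E.
Proof.
elim: n C => [|n IHn] C mC.
  rewrite big_ord0 /= diracE mem_set//=.
  by case.
rewrite big_ord_recl gauss_rowS.
rewrite (_ : _ @^-1` _ =
    C ord0 `*` [set x : 'rV_n | forall j, C (lift ord0 j) (x 0 j)]); last first.
  apply/seteqP; split=> [[a x] /= Cx|[a x] /= [Ca Cx] j].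
    split=> [|j]; first by have := Cx ord0; rewrite row_mx_ord0 mxE eqxx.
    by have := Cx (lift ord0 j); rewrite row_mx_lift.
  case: (unliftP ord0 j) => [l|] ->; first by rewrite row_mx_lift.
  by rewrite row_mx_ord0 mxE eqxx.
rewrite product_measure1E//; last first.
  rewrite [X in measurable X](_ : _ = [set x : 'rV[R]_n | forall i j, C (lift ord0 j) (x i j)]).
    by apply: (measurable_entry_rectangle (C := fun _ j => C (lift ord0 j))) => ? ?.
  by apply/seteqP; split => x Cx => [i j|j]; rewrite ?(ord1 i).
by congr (_ * _)%E; exact: (IHn (fun j => C (lift ord0 j))).
Qed.

Lemma measurable_vec_mx m n :
  measurable_fun setT (vec_mx : 'rV[R]_(m * n) -> 'M[R]_(m, n)).
Proof.
apply/measurable_fun_mxP => i j; under eq_fun do rewrite mxE.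
exact: measurable_mx_entry.
Qed.

Definition gauss m n : probability 'M[R]_(m, n) R :=
  image_prob (gauss_row (m * n)) (@measurable_vec_mx m n).

Lemma gauss_rectangle m n (C : 'I_m -> 'I_n -> set R) :
  (forall i j, measurable (C i j)) ->
  gauss m n [set M | forall i j, C i j (M i j)] =
  (\prod_i \prod_j std_normal (C i j))%E.
Proof.
move=> mC; rewrite /gauss image_probE.
pose D (k : 'I_(m * n)) := C (enum_val (cast_ord (esym (mxvec_cast m n)) k)).1
  (enum_val (cast_ord (esym (mxvec_cast m n)) k)).2.
have DE i j : D (mxvec_index i j) = C i j.
  by rewrite /D /mxvec_index cast_ordK enum_rankK.
rewrite (_ : _ @^-1` _ = [set x : 'rV_(m * n) | forall k, D k (x 0 k)]).
  rewrite gauss_row_rectangle; last by move=> k; exact: mC.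
  rewrite pair_big /= (reindex _ (curry_mxvec_bij m n)) /=.
  by apply: eq_bigr => -[i j] _ /=; rewrite DE.
apply/seteqP; split=> [x Cx k|x Dx i j].
  by case/mxvec_indexP: k => i j; rewrite DE; have := Cx i j; rewrite mxE.
by have := Dx (mxvec_index i j); rewrite DE mxE.
Qed.

(** A probability is recognised as standard Gaussian from the independence of
    the entries alone; all the identities in law below reduce to this. *)
Lemma gauss_unique m n (mu : {measure set 'M[R]_(m, n) -> \bar R}) :
  (forall C : 'I_m -> 'I_n -> set R, (forall i j, measurable (C i j)) ->
    mu [set M | forall i j, C i j (M i j)] =
    (\prod_i \prod_j std_normal (C i j))%E) ->
  forall A, measurable A -> mu A = gauss m n A.
Proof.
move=> muE A mA; apply/esym/mx_measure_unique => //.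
  by rewrite (le_lt_trans (probability_le1 _ _)) ?ltry.
by move=> C mC; rewrite muE//; exact: gauss_rectangle.
Qed.

Lemma gauss_trmx m n A : measurable A ->
  gauss m n ((@trmx R m n) @^-1` A) = gauss n m A.
Proof.
move=> mA.
have mtr : measurable_fun setT (@trmx R m n).
  by apply: measurable_fun_trmx; exact: measurable_id.
rewrite -(image_probE (gauss m n) mtr); apply: gauss_unique => // C mC.
transitivity (gauss m n [set M | forall i j, C j i (M i j)]); last first.
  by have /= -> := gauss_rectangle (fun i j => mC j i); rewrite exchange_big.
congr (gauss m n _).
by apply/seteqP; split => M /= CM i j; have := CM j i; rewrite mxE.
Qed.

Lemma gauss_row_mx k n1 n2 A : measurable A ->
  gauss k (n1 + n2) A =
  (gauss k n1 \x gauss k n2)%E [set M | A (row_mx M.1 M.2)].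
Proof.
move=> mA.
have mrow : measurable_fun setT
    (fun M : 'M[R]_(k, n1) * 'M[R]_(k, n2) => row_mx M.1 M.2).
  by apply: measurable_fun_row_mx; [exact: measurable_fst|exact: measurable_snd].
rewrite -[RHS](image_probE (gauss k n1 \x gauss k n2)%E mrow).
apply/esym/gauss_unique => // C mC.
transitivity ((gauss k n1 \x gauss k n2)%E
    ([set M : 'M[R]_(k, n1) | forall i j, C i (lshift n2 j) (M i j)] `*`
     [set M : 'M[R]_(k, n2) | forall i j, C i (rshift n1 j) (M i j)])).
  congr (product_measure1 _ _ _); apply/seteqP; split=> [[M N] /= CMN|[M N] /= [CM CN] i j].
    by split=> i j; [have := CMN i (lshift n2 j)|have := CMN i (rshift n1 j)];
      rewrite (row_mxEl, row_mxEr).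
  by case: (split_ordP j) => l ->; rewrite (row_mxEl, row_mxEr).
rewrite product_measure1E; first last.
- exact: (measurable_entry_rectangle (C := fun i j => C i (rshift n1 j))).
- exact: (measurable_entry_rectangle (C := fun i j => C i (lshift n2 j))).
have /= -> := gauss_rectangle (fun i j => mC i (lshift n2 j)).
have /= -> := gauss_rectangle (fun i j => mC i (rshift n1 j)).
by rewrite -big_split; apply: eq_bigr => i _; rewrite big_split_ord.
Qed.

Lemma gauss_col_mx k1 k2 n A : measurable A ->
  gauss (k1 + k2) n A =
  (gauss k1 n \x gauss k2 n)%E [set M | A (col_mx M.1 M.2)].
Proof.
move=> mA.
have mcol : measurable_fun setT
    (fun M : 'M[R]_(k1, n) * 'M[R]_(k2, n) => col_mx M.1 M.2).
  by apply: measurable_fun_col_mx; [exact: measurable_fst|exact: measurable_snd].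
rewrite -[RHS](image_probE (gauss k1 n \x gauss k2 n)%E mcol).
apply/esym/gauss_unique => // C mC.
transitivity ((gauss k1 n \x gauss k2 n)%E
    ([set M : 'M[R]_(k1, n) | forall i j, C (lshift k2 i) j (M i j)] `*`
     [set M : 'M[R]_(k2, n) | forall i j, C (rshift k1 i) j (M i j)])).
  congr (product_measure1 _ _ _); apply/seteqP; split=> [[M N] /= CMN|[M N] /= [CM CN] i j].
    by split=> i j; [have := CMN (lshift k2 i) j|have := CMN (rshift k1 i) j];
      rewrite (col_mxEu, col_mxEd).
  by case: (split_ordP i) => l ->; rewrite (col_mxEu, col_mxEd).
rewrite product_measure1E; first last.
- exact: (measurable_entry_rectangle (C := fun i j => C (rshift k1 i) j)).
- exact: (measurable_entry_rectangle (C := fun i j => C (lshift k2 i) j)).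
have /= -> := gauss_rectangle (fun i j => mC (lshift k2 i) j).
have /= -> := gauss_rectangle (fun i j => mC (rshift k1 i) j).
by rewrite big_split_ord.
Qed.

Lemma gauss_columns k n (C : 'I_n -> set 'cV[R]_k) :
  (forall j, measurable (C j)) ->
  gauss k n [set M | forall j, C j (col j M)] = (\prod_j gauss k 1 (C j))%E.
Proof.
elim: n C => [|n IHn] C mC.
  rewrite big_ord0 (_ : [set _ | _] = setT) ?probability_setT//.
  by apply/seteqP; split => // M _ [].
have mCn (n' : nat) (D : 'I_n' -> set 'cV[R]_k) : (forall j, measurable (D j)) ->
    measurable [set M : 'M[R]_(k, n') | forall j, D j (col j M)].
  move=> mD; rewrite [X in measurable X](_ : _ =
      \bigcap_(j in [set: 'I_n']) (col j @^-1` D j)).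
    apply: fin_bigcap_measurable => // j _.
    rewrite -[X in measurable X]setTI.
    exact: (measurable_fun_col j (@measurable_id _ _ setT)).
  by apply/seteqP; split => M DM j; [move=> _; exact: DM|exact: DM].
rewrite (@gauss_row_mx k 1 n); last exact: (mCn n.+1).
rewrite big_ord_recl (_ : [set _ | _] =
    C ord0 `*` [set M : 'M[R]_(k, n) | forall j, C (lift ord0 j) (col j M)]).
  rewrite product_measure1E//; last first.
    exact: (mCn n (fun j => C (lift ord0 j))).
  by congr (_ * _)%E; exact: (IHn (fun j => C (lift ord0 j))).
have colE0 (M : 'cV[R]_k) (N : 'M[R]_(k, n)) :
    col ord0 (row_mx M N : 'M[R]_(k, n.+1)) = M.
  by apply/matrixP => i j; rewrite mxE row_mx_ord0 ord1.
have colES (M : 'cV[R]_k) (N : 'M[R]_(k, n)) j :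
    col (lift ord0 j) (row_mx M N : 'M[R]_(k, n.+1)) = col j N.
  by apply/matrixP => i l; rewrite mxE row_mx_lift mxE.
apply/seteqP; split=> [[M N] /= CMN|[M N] /= [CM CN] j].
  split=> [|j]; first by have := CMN ord0; rewrite colE0.
  by have := CMN (lift ord0 j); rewrite colES.
by case: (unliftP ord0 j) => [l|] ->; [rewrite colES|rewrite colE0].
Qed.

End standard_gaussian.

(** * Rotation invariance *)

Section planar_rotation.
Context {R : realType}.
Local Open Scope ereal_scope.
Let L := measurableTypeR R.
Local Notation lam := (@lebesgue_measure R).

(** The normal density is a Radon-Nikodym derivative of the normal law, which
    allows changes of variables to be made under the Lebesgue measure. *)
Lemma integral_std_normal (f : R -> \bar R) :
  measurable_fun setT f -> (forall x, 0 <= f x) ->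
  \int[@std_normal R]_x f x < +oo ->
  \int[@std_normal R]_x f x = \int[lam]_x (f x * (normal_pdf 0 1 x)%:E).
Proof.
move=> mf f0 foo.
have nE : \int[@std_normal R]_x f x = \int[normal_prob (0 : R) 1]_x f x.
  exact: ge0_integral_pushforward.
rewrite nE in foo *.
have mpdf : measurable_fun setT (fun x : L => (normal_pdf 0 1 x)%:E).
  by apply/measurable_EFinP; exact: measurable_normal_pdf.
have dom := @normal_prob_dominates R 0 1.
rewrite -(Radon_Nikodym_change_of_variables dom)//=; last first.
  apply/integrableP; split => //.
  by under eq_integral do rewrite gee0_abs//.
apply: ae_eq_integral => //.
- apply: emeasurable_funM => //; apply: (measurable_int lam).
- exact: emeasurable_funM mpdf.
- apply: ae_eqe_mul2l => /=.
  rewrite Radon_NikodymE//=.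
  case: cid => /= h [h1 h2 h3].
  apply: integral_ae_eq => //=.
  + by move=> E E01 mE; rewrite -h3.
Qed.

Lemma lebesgue_integral_translation (a : R) (f : L -> \bar R) :
  measurable_fun setT f -> (forall x, 0 <= f x) ->
  \int[lam]_x f (x + a)%R = \int[lam]_x f x.
Proof.
move=> mf f0.
have madd : measurable_fun setT ((fun x => x + a)%R : L -> L).
  by apply: (@measurable_funD _ _ R) => //; exact: measurable_cst.
transitivity (\int[pushforward lam (fun x : L => (x + a)%R : L)]_x f x).
  by rewrite ge0_integral_pushforward.
apply: eq_measure_integral => //= A mA _.
apply/esym/lebesgue_measure_unique => //= _ [[b c]] _ <-.
rewrite /pushforward (_ : _ @^-1` _ = `](b - a)%R, (c - a)%R]%classic).
  rewrite !lebesgue_measure_itv/= !lte_fin ltrD2r.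
  by rewrite -!EFinB opprB addrA subrK.
by apply/seteqP; split => x /=; rewrite !in_itv/= ltrBlDr lerBrDr.
Qed.

Lemma lebesgue_shear2 (a : R) (g : L * L -> \bar R) :
  measurable_fun setT g -> (forall z, 0 <= g z) ->
  \int[lam]_x \int[lam]_y g (x, y + a * x)%R = \int[lam]_x \int[lam]_y g (x, y).
Proof.
move=> mg g0; apply: eq_integral => x _.
apply: (lebesgue_integral_translation (a * x) (f := fun y => g (x, y))) => //.
exact: measurable_fun_pair2.
Qed.

Let measurable_shear1 a :
  measurable_fun setT (fun z : L * L => (z.1 + a * z.2, z.2)%R : L * L).
Proof.
apply/measurable_fun_pair => //=.
by apply: (@measurable_funD _ _ R) => //; apply: (@measurable_funM _ _ R).
Qed.

Let measurable_shear2 a :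
  measurable_fun setT (fun z : L * L => (z.1, z.2 + a * z.1)%R : L * L).
Proof.
apply/measurable_fun_pair => //=.
by apply: (@measurable_funD _ _ R) => //; apply: (@measurable_funM _ _ R).
Qed.

Lemma lebesgue_shear1 (a : R) (g : L * L -> \bar R) :
  measurable_fun setT g -> (forall z, 0 <= g z) ->
  \int[lam]_x \int[lam]_y g (x + a * y, y)%R = \int[lam]_x \int[lam]_y g (x, y).
Proof.
move=> mg g0.
pose h (z : L * L) := g (z.1 + a * z.2, z.2)%R.
have mh : measurable_fun setT h.
  exact: (measurableT_comp mg (measurable_shear1 a)).
rewrite (@fubini_tonelli _ _ _ _ R lam lam h mh (fun=> g0 _)).
rewrite [RHS](@fubini_tonelli _ _ _ _ R lam lam g mg g0).
apply: eq_integral => y _.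
apply: (lebesgue_integral_translation (a * y) (f := fun x => g (x, y))) => //.
exact: measurable_fun_pair1.
Qed.

(** Apart from the half-turn, a rotation of the plane is a product of three
    shears, each of which preserves the area by Fubini and translation
    invariance. *)
Lemma lebesgue_rotation (c s : R) (g : L * L -> \bar R) :
  (c ^+ 2 + s ^+ 2 = 1)%R -> (c != -1)%R ->
  measurable_fun setT g -> (forall z, 0 <= g z) ->
  \int[lam]_x \int[lam]_y g (c * x + s * y, - s * x + c * y)%R =
  \int[lam]_x \int[lam]_y g (x, y).
Proof.
move=> cs c1 mg g0; have c10 : (1 + c != 0)%R by rewrite addrC addr_eq0.
(* the tangent of half the angle *)
pose t := (s / (1 + c))%R.
have tE : (t * (1 + c) = s)%R by rewrite /t divfK.
have tsE : (1 - t * s = c)%R.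
  apply: (mulIf c10); rewrite mulrBl mulrAC tE mul1r.
  by move: cs; rewrite !expr2 => cs; lra.
clearbody t.
pose g1 (z : L * L) := g (z.1 + t * z.2, z.2)%R.
have mg1 : measurable_fun setT g1.
  exact: (measurableT_comp mg (measurable_shear1 t)).
pose g2 (z : L * L) := g1 (z.1, z.2 + - s * z.1)%R.
have mg2 : measurable_fun setT g2.
  exact: (measurableT_comp mg1 (measurable_shear2 (- s)%R)).
have E1 := lebesgue_shear1 t mg g0.
have E2 := lebesgue_shear2 (- s) mg1 (fun=> g0 _).
have E3 := lebesgue_shear1 t mg2 (fun=> g0 _).
transitivity (\int[lam]_x \int[lam]_y g2 (x + t * y, y)%R); last first.
  exact: (etrans E3 (etrans E2 E1)).
have rot1 (x y : R) : (c * x + s * y = x + t * y + t * (y + - s * (x + t * y)))%R.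
  by rewrite -[X in (_ + X * y)%R]tE -tsE; ring.
have rot2 (x y : R) : (- s * x + c * y = y + - s * (x + t * y))%R.
  by rewrite -tsE; ring.
by apply: eq_integral => x _; apply: eq_integral => y _; rewrite rot1 rot2.
Qed.

Lemma std_normal2E (E : set (R * R)) : measurable E ->
  (@std_normal R \x @std_normal R) E =
  \int[lam]_x \int[lam]_y
    (\1_E (x, y) * (normal_pdf 0 1 x * normal_pdf 0 1 y))%:E.
Proof.
move=> mE; have pdf0 := @normal_pdf_ge0 R 0 1.
have mpdf : measurable_fun setT (normal_pdf 0 1 : R -> R).
  exact: measurable_normal_pdf.
rewrite /product_measure1 integral_std_normal//; last first.
- apply: (@le_lt_trans _ _ ((@std_normal R \x @std_normal R) E)) => //.
  by rewrite (le_lt_trans (probability_le1 _ _)) ?ltry.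
- exact: measurable_fun_xsection.
apply: eq_integral => x _.
have mx : measurable (xsection E x) by exact: measurable_xsection.
rewrite /= preimage_id {1}/normal_prob.
rewrite integral_mkcond -ge0_integralZr//; last 3 first.
- apply/(measurable_restrictT _ mx)/measurable_EFinP/measurable_funTS.
  exact: measurable_normal_pdf.
- by move=> y _; rewrite patchE; case: ifP => // _; rewrite lee_fin.
- by rewrite lee_fin.
apply: eq_integral => y _; rewrite patchE indicE mem_xsection.
case: ((x, y) \in E); last by rewrite mul0e mul0r.
by rewrite mul1r -EFinM mulrC.
Qed.

Let normal_pdf2 (x y : R) : (normal_pdf 0 1 x * normal_pdf 0 1 y =
  normal_peak 1 ^+ 2 * expR (- (x ^+ 2 + y ^+ 2) / 2))%R.
Proof.
rewrite /normal_pdf oner_eq0 /normal_fun !subr0 expr1n.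
rewrite mulrACA -expRD expr2; congr (_ * expR _)%R.
by rewrite -mulrDl opprD.
Qed.

(** The planar Gaussian density depends on the norm only, and rotations preserve
    both the norm and the area. *)
Lemma std_normal2_rotation (c s : R) (E : set (R * R)) :
  (c ^+ 2 + s ^+ 2 = 1)%R -> measurable E ->
  (@std_normal R \x @std_normal R)
    [set z : R * R | E (c * z.1 + s * z.2, - s * z.1 + c * z.2)%R] =
  (@std_normal R \x @std_normal R) E.
Proof.
have mrot a b : measurable_fun setT
    (fun z : R * R => (a * z.1 + b * z.2, - b * z.1 + a * z.2)%R).
  by apply/measurable_fun_pair => /=; apply: measurable_funD => //;
    apply: measurable_funM => //; exact: measurable_cst.
have mrotE (a b : R) (F : set (R * R)) : measurable F ->
    measurable [set z : R * R | F (a * z.1 + b * z.2, - b * z.1 + a * z.2)%R].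
  by move=> mF; rewrite -[X in measurable X]setTI; exact: mrot.
have rot (a b : R) (F : set (R * R)) : (a ^+ 2 + b ^+ 2 = 1)%R -> (a != -1)%R -> measurable F ->
    (@std_normal R \x @std_normal R)
      [set z : R * R | F (a * z.1 + b * z.2, - b * z.1 + a * z.2)%R] =
    (@std_normal R \x @std_normal R) F.
  move=> ab a1 mF.
  pose g (z : L * L) :=
    (\1_F z * (normal_peak 1 ^+ 2 * expR (- (z.1 ^+ 2 + z.2 ^+ 2) / 2)))%:E.
  have g0 z : 0 <= g z.
    by rewrite lee_fin !mulr_ge0// ?exprn_ge0 ?normal_peak_ge0 ?expR_ge0.
  have mg : measurable_fun setT g.
    apply/measurable_EFinP; apply: (@measurable_funM _ _ R).
      exact: measurable_indic.
    apply: (@measurable_funM _ _ R); first exact: measurable_cst.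
    apply: (measurableT_comp (@measurable_expR R)).
    apply: (@measurable_funM _ _ R); last exact: measurable_cst.
    apply: measurableT_comp => //.
    by apply: (@measurable_funD _ _ R); apply: measurable_funX.
  have nrm (x y : R) :
      ((a * x + b * y) ^+ 2 + (- b * x + a * y) ^+ 2 = x ^+ 2 + y ^+ 2)%R.
    by rewrite -[RHS]mul1r -ab; ring.
  have gE : (@std_normal R \x @std_normal R) F =
      \int[lam]_x \int[lam]_y g (x, y).
    rewrite (std_normal2E mF).
    by apply: eq_integral => x _; apply: eq_integral => y _; rewrite normal_pdf2.
  have gE' : (@std_normal R \x @std_normal R)
        [set z : R * R | F (a * z.1 + b * z.2, - b * z.1 + a * z.2)%R] =
      \int[lam]_x \int[lam]_y g (a * x + b * y, - b * x + a * y)%R.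
    rewrite (std_normal2E (mrotE a b F mF)).
    apply: eq_integral => x _; apply: eq_integral => y _.
    by rewrite normal_pdf2 -(nrm x y).
  rewrite gE gE'; exact: (lebesgue_rotation ab a1 mg g0).
move=> cs mE; have [c1|c1] := eqVneq c (-1)%R; last exact: rot.
have s0 : s = 0%R.
  apply/eqP; rewrite -sqrf_eq0; apply/eqP; move: cs; rewrite c1 sqrrN expr1n.
  by move=> /(canRL (addKr _)) ->; rewrite addNr.
(* the half-turn is the square of a quarter-turn *)
have q1 : ((0 : R) ^+ 2 + 1 ^+ 2 = 1)%R by rewrite expr0n expr1n add0r.
have q0 : (0 != -1 :> R)%R by rewrite eq_sym oppr_eq0 oner_eq0.
rewrite -(rot _ _ E q1 q0 mE) -(rot _ _ _ q1 q0 (mrotE 0 1 E mE)%R).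
congr (product_measure1 _ _ _); apply/seteqP; split=> -[x y] /=;
  by rewrite c1 s0 !(mul0r, mul1r, mulN1r, add0r, addr0, oppr0).
Qed.

End planar_rotation.

Section gaussian_symmetries.
Context {R : realType}.
Implicit Types k m n : nat.

Lemma product_prob_preserving d1 d2 (T1 : measurableType d1)
    (T2 : measurableType d2) (P1 : probability T1 R) (P2 : probability T2 R)
    (f : T1 -> T1) (g : T2 -> T2) (A : set (T1 * T2)) :
  measurable_fun setT f -> measurable_fun setT g ->
  (forall B, measurable B -> P1 (f @^-1` B) = P1 B) ->
  (forall B, measurable B -> P2 (g @^-1` B) = P2 B) ->
  measurable A ->
  (P1 \x P2)%E [set z | A (f z.1, g z.2)] = (P1 \x P2)%E A.
Proof.
move=> mf mg fP gP mA.
have mfg : measurable_fun setT (fun z : T1 * T2 => (f z.1, g z.2)).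
  by apply/measurable_fun_pair => /=; apply: measurableT_comp.
rewrite [RHS](product_measure_unique (m' := image_prob (P1 \x P2)%E mfg))//.
move=> B C mB mC.
transitivity ((P1 \x P2)%E ((f @^-1` B) `*` (g @^-1` C))); first by [].
have mfB : measurable (f @^-1` B) by rewrite -[X in measurable X]setTI; exact: mf.
have mgC : measurable (g @^-1` C) by rewrite -[X in measurable X]setTI; exact: mg.
by rewrite product_measure1E//= fP// gP.
Qed.

(** Invariance is required for every number of rows, so that it can be applied to
    matrices with any covariance of their columns. *)
Definition gauss_invariant n (O : 'M[R]_n) : Prop :=
  forall k (A : set 'M[R]_(k, n)), measurable A ->
  gauss k n [set M | A (M *m O)] = gauss k n A.

Lemma gauss_invariant1 n : gauss_invariant (1%:M : 'M[R]_n).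
Proof.
move=> k A mA; congr (gauss k n _).
by apply/seteqP; split=> M /=; rewrite mulmx1.
Qed.

Lemma gauss_invariantM n (O1 O2 : 'M[R]_n) :
  gauss_invariant O1 -> gauss_invariant O2 -> gauss_invariant (O1 *m O2).
Proof.
move=> inv1 inv2 k A mA; rewrite -(inv2 k A mA).
rewrite -(inv1 k _ (measurable_preimageT (measurable_mulmxl O2) mA)).
by congr (gauss k n _); apply/seteqP; split=> M /=; rewrite mulmxA.
Qed.

Lemma gauss_invariant_tr n (O : 'M[R]_n) :
  O *m O^T = 1%:M -> gauss_invariant O -> gauss_invariant O^T.
Proof.
move=> OO inv k A mA; rewrite -(inv k _ (measurable_preimageT (measurable_mulmxl O^T) mA)).
by congr (gauss k n _); apply/seteqP; split=> M /=; rewrite -mulmxA OO mulmx1.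
Qed.

Lemma gauss_invariant_block n1 n2 (O1 : 'M[R]_n1) (O2 : 'M[R]_n2) :
  gauss_invariant O1 -> gauss_invariant O2 ->
  gauss_invariant (block_mx O1 0 0 O2).
Proof.
move=> inv1 inv2 k A mA; rewrite !gauss_row_mx//; last first.
  exact: (measurable_preimageT (measurable_mulmxl _)).
have mrow : measurable_fun setT
    (fun M : 'M[R]_(k, n1) * 'M[R]_(k, n2) => row_mx M.1 M.2).
  by apply: measurable_fun_row_mx; [exact: measurable_fst|exact: measurable_snd].
rewrite -[RHS](product_prob_preserving (measurable_mulmxl O1) (measurable_mulmxl O2)
  (inv1 k) (inv2 k)); last first.
  by rewrite -[X in measurable X]setTI; apply: mrow.
congr (product_measure1 _ _ _); apply/seteqP; split=> -[M N] /=;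
  by rewrite mul_row_block !mulmx0 addr0 add0r.
Qed.

(** The rows of a Gaussian matrix are independent and a right multiplication acts
    on each of them separately, so one row is enough. *)
Lemma gauss_invariant_row n (O : 'M[R]_n) :
  (forall A, measurable A -> gauss 1 n [set M | A (M *m O)] = gauss 1 n A) ->
  gauss_invariant O.
Proof.
move=> inv1; elim=> [|k IHk] A mA.
  by congr (gauss 0 n _); apply/seteqP; split=> M /=;
    rewrite (flatmx0 (M *m O)) (flatmx0 M).
rewrite !(@gauss_col_mx R 1 k n)//; last exact: (measurable_preimageT (measurable_mulmxl _)).
have mcol : measurable_fun setT
    (fun M : 'M[R]_(1, n) * 'M[R]_(k, n) => col_mx M.1 M.2).
  by apply: measurable_fun_col_mx; [exact: measurable_fst|exact: measurable_snd].
rewrite -[RHS](product_prob_preserving (measurable_mulmxl O) (measurable_mulmxl O)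
  inv1 IHk); last first.
  by rewrite -[X in measurable X]setTI; apply: mcol.
congr (product_measure1 _ _ _); apply/seteqP; split=> -[M N] /=;
  by rewrite (@mul_col_mx _ 1 k).
Qed.

Let rv2 (z : R * R) : 'M[R]_(1, 1 + 1) := row_mx z.1%:M z.2%:M.

Let measurable_rv2 : measurable_fun setT rv2.
Proof.
by apply: measurable_fun_row_mx; apply: measurable_fun_scalar_mx;
  [exact: measurable_fst|exact: measurable_snd].
Qed.

Let gauss12 A : measurable A ->
  gauss 1 (1 + 1) A = (@std_normal R \x @std_normal R)%E (rv2 @^-1` A).
Proof.
move=> mA; rewrite -[RHS](image_probE (@std_normal R \x @std_normal R)%E measurable_rv2).
apply/esym/gauss_unique => // C mC.
transitivity ((@std_normal R \x @std_normal R)%E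
    (C 0 (lshift 1 0) `*` C 0 (rshift 1 0))).
  congr (product_measure1 _ _ _); apply/seteqP; split=> [[x y] /= Cxy|[x y] /= [Cx Cy] i j].
    have := Cxy 0 (lshift 1 0); have := Cxy 0 (rshift 1 0).
    by rewrite row_mxEl row_mxEr !mxE.
  by rewrite (ord1 i); case: (split_ordP j) => l ->; rewrite (ord1 l)
    ?row_mxEl ?row_mxEr !mxE.
by rewrite product_measure1E// big_ord1 big_split_ord !big_ord1.
Qed.

Definition givens (c s : R) : 'M[R]_(1 + 1) :=
  block_mx c%:M (- s)%:M s%:M c%:M.

Lemma givens_orthogonal c s : c ^+ 2 + s ^+ 2 = 1 ->
  givens c s *m (givens c s)^T = 1%:M.
Proof.
move=> cs; rewrite tr_block_mx !tr_scalar_mx mulmx_block -!scalar_mxM.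
rewrite -!raddfD /= scalar_mx_block.
by congr block_mx; rewrite -?[0 in RHS](raddf0 (@scalar_mx R 1)); congr (_%:M);
  rewrite -?cs; ring.
Qed.

Lemma gauss_invariant_givens c s : c ^+ 2 + s ^+ 2 = 1 ->
  gauss_invariant (givens c s).
Proof.
move=> cs; apply: gauss_invariant_row => A mA.
rewrite (gauss12 mA) (gauss12 (measurable_preimageT (measurable_mulmxl (givens c s)) mA)).
rewrite -[RHS](std_normal2_rotation cs); last first.
  by rewrite -[X in measurable X]setTI; exact: measurable_rv2.
congr (product_measure1 _ _ _); apply/seteqP; split=> -[x y] /=;
  rewrite /rv2 /= mul_row_block -!scalar_mxM -!raddfD /=;
  by rewrite [x * c]mulrC [y * s]mulrC [y * c]mulrC [x * - s]mulrC.
Qed.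

(** The sign change of one column is a marginal of the half-turn of two. *)
Lemma gauss_invariantN1 : gauss_invariant (- 1%:M : 'M[R]_1).
Proof.
move=> k A mA.
have lA (B : set 'M[R]_(k, 1)) : measurable B ->
    gauss k 1 B = gauss k (1 + 1) [set M | B (lsubmx M)].
  move=> mB; rewrite gauss_row_mx; last first.
    rewrite -[X in measurable X]setTI.
    have ml : measurable_fun setT (fun M : 'M[R]_(k, 1 + 1) => lsubmx M).
      apply/measurable_fun_mxP => i j; under eq_fun do rewrite mxE.
      exact: measurable_mx_entry.
    exact: ml.
  transitivity ((gauss k 1 \x gauss k 1)%E (B `*` setT)).
    rewrite product_measure1E// -[LHS]mule1; congr (_ * _)%E.
    exact/esym/probability_setT.
  by congr (product_measure1 _ _ _); apply/seteqP; split=> -[M N] /=;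
    rewrite row_mxKl => // -[].
have cs : (-1) ^+ 2 + 0 ^+ 2 = 1 :> R by rewrite sqrrN expr1n expr0n addr0.
rewrite !lA//; last exact: (measurable_preimageT (measurable_mulmxl _)).
rewrite -[RHS](gauss_invariant_givens cs); last first.
  rewrite -[X in measurable X]setTI.
  have ml : measurable_fun setT (fun M : 'M[R]_(k, 1 + 1) => lsubmx M).
    apply/measurable_fun_mxP => i j; under eq_fun do rewrite mxE.
    exact: measurable_mx_entry.
  exact: ml.
have giv (M : 'M[R]_(k, 1 + 1)) :
    lsubmx (M *m givens (-1) 0) = lsubmx M *m - 1%:M.
  rewrite -[in LHS](hsubmxK M) mul_row_block row_mxKl raddf0 mulmx0 addr0.
  by rewrite mul_mx_scalar scaleN1r mulmxN mulmx1.
by congr (gauss k (1 + 1) _); apply/seteqP; split=> M /=; rewrite giv.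
Qed.

Lemma row_mx_assoc k n (M1 M2 : 'cV[R]_k) (N : 'M[R]_(k, n)) :
  (row_mx M1 (row_mx M2 N) : 'M[R]_(k, n.+2)) = row_mx (row_mx M1 M2) N.
Proof.
rewrite row_mxA; set e := (_, _).
by rewrite (_ : e = (erefl k, erefl n.+2)) ?castmx_id//; congr pair; exact: eq_irrelevance.
Qed.

End gaussian_symmetries.

(** * Matrices with the same Gram matrix *)

Section gram_orbits.
Context {R : realType}.
Implicit Types d k m n : nat.

Lemma orthogonal_block n1 n2 (O1 : 'M[R]_n1) (O2 : 'M[R]_n2) :
  O1 *m O1^T = 1%:M -> O2 *m O2^T = 1%:M ->
  block_mx O1 0 0 O2 *m (block_mx O1 0 0 O2)^T = 1%:M.
Proof.
move=> OO1 OO2; rewrite tr_block_mx mulmx_block !trmx0 !(mulmx0, mul0mx).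
by rewrite !(addr0, add0r) OO1 OO2 -scalar_mx_block.
Qed.

Lemma mul_row_trmx p q n (x : 'cV[R]_p) (y : 'M[R]_(p, n))
    (x' : 'cV[R]_q) (y' : 'M[R]_(q, n)) :
  (row_mx x y : 'M[R]_(p, n.+1)) *m (row_mx x' y' : 'M[R]_(q, n.+1))^T =
  x *m x'^T + y *m y'^T.
Proof. exact: etrans (congr1 (mulmx _) (tr_row_mx x' y')) (mul_row_col _ _ _ _). Qed.

Lemma gram_row_mx n (a : R) (w : 'rV[R]_n) :
  (row_mx a%:M w *m (row_mx a%:M w)^T) 0 0 = a ^+ 2 + (w *m w^T) 0 0.
Proof. by rewrite tr_row_mx mul_row_col tr_scalar_mx -scalar_mxM !mxE eqxx. Qed.

Lemma gram_row_ge0 n (v : 'rV[R]_n) : 0 <= (v *m v^T) 0 0.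
Proof. by rewrite mxE sumr_ge0// => j _; rewrite mxE -expr2 sqr_ge0. Qed.

Lemma gram_row_eq0 n (v : 'rV[R]_n) : (v *m v^T) 0 0 = 0 -> v = 0.
Proof.
rewrite mxE => v0; apply/rowP => j; rewrite mxE; apply/eqP; rewrite -sqrf_eq0.
have /psumr_eq0P/(_ v0 j isT) : forall j, true -> 0 <= v 0 j * (v^T) j 0.
  by move=> l _; rewrite mxE -expr2 sqr_ge0.
by rewrite mxE -expr2 => ->.
Qed.

(** Rotate the tail of the row to its first axis, then the plane of the first two
    coordinates. *)
Lemma rotate_row_to_axis n (v : 'rV[R]_n.+1) :
  exists O : 'M[R]_n.+1, [/\ O *m O^T = 1%:M, gauss_invariant O &
    v *m O = row_mx (Num.sqrt ((v *m v^T) 0 0))%:M (0 : 'rV[R]_n)].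
Proof.
elim: n v => [|n IHn] v.
  have vE : v = (v 0 0)%:M by apply/matrixP => i j; rewrite !ord1 mxE eqxx.
  have sE : Num.sqrt ((v *m v^T) 0 0) = `|v 0 0|.
    by rewrite mxE big_ord1 mxE -expr2 sqrtr_sqr.
  have rE (a : R) : row_mx a%:M (0 : 'rV[R]_0) = a%:M :> 'rV[R]_1.
    by apply/matrixP => i j; rewrite !ord1 (row_mx_ord0 (n := 0)).
  have [v0|v0] := leP 0 (v 0 0).
    exists 1%:M; split; first by rewrite trmx1 mulmx1.
      exact: gauss_invariant1.
    by rewrite mulmx1 rE sE ger0_norm.
  exists (- 1%:M); split; first by rewrite linearN /= trmx1 mulNmx mulmxN opprK mulmx1.
    exact: gauss_invariantN1.
  by rewrite mulmxN mulmx1 rE sE ltr0_norm// raddfN /= -vE.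
pose a := v 0 ord0; pose w : 'rV[R]_n.+1 := rsubmx (v : 'rV[R]_(1 + n.+1)).
have vE : v = row_mx a%:M w :> 'rV[R]_(1 + n.+1).
  rewrite -[LHS](@hsubmxK _ 1 1 n.+1); congr row_mx; apply/matrixP => i j.
  by rewrite !ord1 !mxE eqxx mulr1n; congr (v _ _); exact/val_inj.
have [U [UU invU wU]] := IHn w.
set r' := Num.sqrt _ in wU.
pose r := Num.sqrt (a ^+ 2 + r' ^+ 2).
have vv : (v *m v^T) 0 0 = a ^+ 2 + r' ^+ 2.
  transitivity ((row_mx a%:M w *m (row_mx a%:M w)^T) 0 0); first by rewrite -vE.
  by rewrite gram_row_mx sqr_sqrtr// gram_row_ge0.
have rr : r ^+ 2 = a ^+ 2 + r' ^+ 2 by rewrite sqr_sqrtr// addr_ge0// sqr_ge0.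
have [r0|r0] := eqVneq r 0.
  exists 1%:M; split; first by rewrite trmx1 mulmx1.
    exact: gauss_invariant1.
  have v0 : v = 0 by apply: gram_row_eq0; rewrite vv -rr r0 expr0n.
  by rewrite vv -/r r0 v0 mul0mx raddf0 row_mx0.
pose c := a / r; pose s := r' / r.
have cs : c ^+ 2 + s ^+ 2 = 1.
  by rewrite /c /s !expr_div_n -mulrDl -rr divff// sqrf_eq0.
pose O1 : 'M[R]_(1 + n.+1) := block_mx 1%:M 0 0 U.
pose O2 : 'M[R]_(1 + 1 + n) := block_mx (givens c s) 0 0 1%:M.
have OO1 : O1 *m O1^T = 1%:M.
  by apply: orthogonal_block => //; rewrite trmx1 mulmx1.
have OO2 : O2 *m O2^T = 1%:M.
  by apply: orthogonal_block; [exact: givens_orthogonal|rewrite trmx1 mulmx1].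
have invO1 : gauss_invariant O1.
  by apply: gauss_invariant_block => //; exact: gauss_invariant1.
have invO2 : gauss_invariant O2.
  apply: gauss_invariant_block; last exact: gauss_invariant1.
  exact: gauss_invariant_givens.
exists (O1 *m (O2 : 'M[R]_n.+2)); split.
- by rewrite trmx_mul -mulmxA (mulmxA O2 _ (O1^T)) OO2 mul1mx OO1.
- exact: gauss_invariantM invO1 invO2.
- have vO1 : (v : 'rV[R]_(1 + n.+1)) *m O1 = row_mx a%:M (row_mx r'%:M (0 : 'rV[R]_n)).
    by rewrite vE mul_row_block !mulmx0 mulmx1 addr0 add0r wU.
  have vO2 : row_mx (row_mx a%:M r'%:M) (0 : 'rV[R]_n) *m O2 =
      row_mx (row_mx r%:M (0 : 'rV[R]_1)) (0 : 'rV[R]_n).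
    rewrite mul_row_block !mulmx0 addr0 add0r mul0mx.
    rewrite mul_row_block -!scalar_mxM -!raddfD /=.
    have -> : a * c + r' * s = r.
      by rewrite /c /s !mulrA -mulrDl -!expr2 -rr expr2 mulfK.
    by have -> : a * - s + r' * c = 0 by [rewrite /c /s; ring]; rewrite raddf0.
  rewrite mulmxA; apply: etrans (congr1 (mulmx^~ (O2 : 'M[R]_n.+2)) vO1) _.
  rewrite row_mx_assoc; apply: etrans vO2 _.
  by rewrite -row_mx_assoc row_mx0 vv.
Qed.

(** The Gram matrix determines the rows up to a common rotation: both first rows
    are rotated to the same axis; if they do not vanish, the first columns then
    agree, and the induction continues in the remaining rows and columns. The
    rotation is a product of moves which preserve Gaussian matrices. *)
Lemma gram_orbit d n (z1 z2 : 'M[R]_(d, n)) :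
  z1 *m z1^T = z2 *m z2^T ->
  exists O : 'M[R]_n, [/\ O *m O^T = 1%:M, gauss_invariant O & z1 *m O = z2].
Proof.
elim: d n z1 z2 => [|d IHd] n z1 z2 zz.
  exists 1%:M; split; first by rewrite trmx1 mulmx1.
    exact: gauss_invariant1.
  by rewrite (flatmx0 z2) (flatmx0 (_ *m _)).
case: n z1 z2 zz => [|n] z1 z2 zz.
  exists 1%:M; split; first by rewrite trmx1 mulmx1.
    exact: gauss_invariant1.
  by rewrite (thinmx0 z2) (thinmx0 (_ *m _)).
pose u1 : 'rV[R]_n.+1 := usubmx (z1 : 'M[R]_(1 + d, n.+1)).
pose w1 : 'M[R]_(d, n.+1) := dsubmx (z1 : 'M[R]_(1 + d, n.+1)).
pose u2 : 'rV[R]_n.+1 := usubmx (z2 : 'M[R]_(1 + d, n.+1)).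
pose w2 : 'M[R]_(d, n.+1) := dsubmx (z2 : 'M[R]_(1 + d, n.+1)).
have z1E : z1 = col_mx u1 w1 :> 'M[R]_(1 + d, n.+1) by rewrite vsubmxK.
have z2E : z2 = col_mx u2 w2 :> 'M[R]_(1 + d, n.+1) by rewrite vsubmxK.
have : col_mx u1 w1 *m (col_mx u1 w1)^T = col_mx u2 w2 *m (col_mx u2 w2)^T.
  by rewrite -z1E -z2E.
rewrite !tr_col_mx !mul_col_row.
move=> /eq_block_mx[uu uw _ ww].
have [ O1 [ OO1 inv1 uO1]] := rotate_row_to_axis u1.
have [ O2 [ OO2 inv2 uO2]] := rotate_row_to_axis u2.
set r := Num.sqrt _ in uO1; rewrite -uu -/r in uO2.
have orthC (O : 'M[R]_n.+1) : O *m O^T = 1%:M -> O^T *m O = 1%:M by exact: mulmx1C.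
have [r0|r0] := eqVneq r 0.
  have u10 : u1 = 0.
    by rewrite -(mulmx1 u1) -OO1 mulmxA uO1 r0 raddf0 row_mx0 mul0mx.
  have u20 : u2 = 0.
    by rewrite -(mulmx1 u2) -OO2 mulmxA uO2 r0 raddf0 row_mx0 mul0mx.
  have [ O [ OO inv wO]] := IHd _ _ _ ww.
  by exists O; split; rewrite // z1E z2E (@mul_col_mx _ 1 d) wO u10 u20 mul0mx.
pose b1 : 'cV[R]_d := lsubmx (w1 *m O1 : 'M[R]_(d, 1 + n)).
pose m1 : 'M[R]_(d, n) := rsubmx (w1 *m O1 : 'M[R]_(d, 1 + n)).
pose b2 : 'cV[R]_d := lsubmx (w2 *m O2 : 'M[R]_(d, 1 + n)).
pose m2 : 'M[R]_(d, n) := rsubmx (w2 *m O2 : 'M[R]_(d, 1 + n)).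
have w1E : w1 *m O1 = row_mx b1 m1 :> 'M[R]_(d, 1 + n) by rewrite hsubmxK.
have w2E : w2 *m O2 = row_mx b2 m2 :> 'M[R]_(d, 1 + n) by rewrite hsubmxK.
have rot p q (O : 'M[R]_n.+1) (x : 'M[R]_(p, n.+1)) (y : 'M[R]_(q, n.+1)) :
    O *m O^T = 1%:M -> x *m y^T = (x *m O) *m (y *m O)^T.
  by move=> OO; rewrite trmx_mul mulmxA -(mulmxA x) OO mulmx1.
have b12 : b1 = b2.
  move: uw; rewrite (rot _ _ O1)// (rot _ _ O2 u2)// uO1 uO2 w1E w2E !mul_row_trmx.
  rewrite !mul0mx !addr0 !mul_scalar_mx => /(scalerI r0)/trmx_inj.
  by [].
have mm : m1 *m m1^T = m2 *m m2^T.
  move: ww; rewrite (rot _ _ O1)// (rot _ _ O2 w2)// w1E w2E !mul_row_trmx.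
  by rewrite b12 => /addrI.
have [ O3 [ OO3 inv3 mO3]] := IHd _ _ _ mm.
pose O : 'M[R]_(1 + n) := block_mx 1%:M 0 0 O3.
have OO : O *m O^T = 1%:M.
  by apply: orthogonal_block => //; rewrite trmx1 mulmx1.
have invO : gauss_invariant O.
  by apply: gauss_invariant_block => //; exact: gauss_invariant1.
exists (O1 *m (O : 'M[R]_n.+1) *m O2^T); split.
- rewrite !trmx_mul trmxK -!mulmxA (mulmxA O2^T) orthC// mul1mx.
  by rewrite (mulmxA (O : 'M[R]_n.+1)) OO mul1mx.
- exact: gauss_invariantM (gauss_invariantM inv1 invO) (gauss_invariant_tr OO2 inv2).
- have uO : row_mx r%:M (0 : 'rV[R]_n) *m O = row_mx r%:M 0.
    by rewrite mul_row_block !mulmx0 mul0mx mulmx1 !addr0.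
  have wO : row_mx b1 m1 *m O = row_mx b2 m2.
    by rewrite mul_row_block !mulmx0 mulmx1 addr0 add0r mO3 b12.
  have uE : u1 *m (O1 *m (O : 'M[R]_n.+1) *m O2^T) = u2.
    by rewrite !mulmxA uO1 (uO : _ *m (O : 'M[R]_n.+1) = _) -uO2 -mulmxA OO2 mulmx1.
  have wE : w1 *m (O1 *m (O : 'M[R]_n.+1) *m O2^T) = w2.
    by rewrite !mulmxA w1E (wO : _ *m (O : 'M[R]_n.+1) = _) -w2E -mulmxA OO2 mulmx1.
  by rewrite z1E z2E (@mul_col_mx _ 1 d) uE wE.
Qed.

(** A left multiplication is a right one after transposition. *)
Lemma gauss_invariant_mull n k (O : 'M[R]_k) (A : set 'M[R]_(k, n)) :
  O *m O^T = 1%:M -> gauss_invariant O -> measurable A ->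
  gauss k n [set M | A (O *m M)] = gauss k n A.
Proof.
move=> OO inv mA.
have mAt : measurable (@trmx R n k @^-1` A).
  apply: measurable_preimageT => //.
  by apply: measurable_fun_trmx; exact: measurable_id.
have mOA : measurable [set M : 'M[R]_(k, n) | A (O *m M)].
  exact: (measurable_preimageT (measurable_mulmxr O)).
rewrite -gauss_trmx// -[RHS]gauss_trmx//.
rewrite -(gauss_invariant_tr OO inv mAt).
by congr (gauss n k _); apply/seteqP; split=> M /=; rewrite trmx_mul trmxK.
Qed.

(** The law of [L *m G] depends on the covariance [L *m L^T] only. The two factors
    may have different widths: padded with zero blocks to the common width
    [k1 + k2], they lie in one orbit of the rotations. *)
Lemma gauss_mulmx_law d k1 k2 n (L1 : 'M[R]_(d, k1)) (L2 : 'M[R]_(d, k2))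
    (A : set 'M[R]_(d, n)) :
  L1 *m L1^T = L2 *m L2^T -> measurable A ->
  gauss k1 n [set G | A (L1 *m G)] = gauss k2 n [set G | A (L2 *m G)].
Proof.
move=> LL mA.
have mL k (L : 'M[R]_(d, k)) : measurable [set G : 'M[R]_(k, n) | A (L *m G)].
  exact: (measurable_preimageT (measurable_mulmxr L)).
have [ O [ OO inv zO]] : exists O, [/\ O *m O^T = 1%:M, gauss_invariant O &
    row_mx L1 (0 : 'M[R]_(d, k2)) *m O = row_mx (0 : 'M[R]_(d, k1)) L2].
  apply: gram_orbit; rewrite !tr_row_mx !mul_row_col !trmx0 !mulmx0.
  by rewrite addr0 add0r.
have -> : gauss k1 n [set G | A (L1 *m G)] =
    gauss (k1 + k2) n [set G | A (row_mx L1 (0 : 'M[R]_(d, k2)) *m G)].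
  rewrite gauss_col_mx; last exact: mL.
  transitivity ((gauss k1 n \x gauss k2 n)%E ([set G | A (L1 *m G)] `*` setT)).
    rewrite (product_measure1E _ _ (mL _ L1) measurableT) -[LHS]mule1; congr (_ * _)%E.
    exact/esym/probability_setT.
  congr (product_measure1 _ _ _); apply/seteqP; split=> -[M N] /=;
    by rewrite mul_row_col mul0mx addr0 => // -[].
have -> : gauss k2 n [set G | A (L2 *m G)] =
    gauss (k1 + k2) n [set G | A (row_mx (0 : 'M[R]_(d, k1)) L2 *m G)].
  rewrite gauss_col_mx; last exact: mL.
  transitivity ((gauss k1 n \x gauss k2 n)%E (setT `*` [set G | A (L2 *m G)])).
    rewrite (product_measure1E _ _ measurableT (mL _ L2)) -[LHS]mul1e; congr (_ * _)%E.
    exact/esym/probability_setT.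
  congr (product_measure1 _ _ _); apply/seteqP; split=> -[M N] /=;
    by rewrite mul_row_col mul0mx add0r => // -[].
rewrite -zO -(gauss_invariant_mull OO inv (mL _ _)).
by congr (gauss _ n _); apply/seteqP; split=> M /=; rewrite mulmxA.
Qed.

End gram_orbits.

(** * Independence *)

Section independence.
Context {d} {T : measurableType d} {R : realType} (P : probability T R).

(** This saves numbering the subfamilies which are indexed by pairs. *)
Lemma mutually_independent_fin (I : Type) (F : I -> set (set T)) (J : finType)
    (f : J -> I) (E : J -> set T) :
  mutually_independent P F -> injective f -> (forall j, F (f j) (E j)) ->
  P (\bigcap_j E j) = (\prod_j P (E j))%E.
Proof.
move=> indep f_inj FE.
have h_inj : injective (fun i : 'I_#|J| => f (enum_val i)).
  by move=> i i' /f_inj/enum_val_inj.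
have := indep _ _ (fun i => E (enum_val i)) h_inj (fun i => FE _).
have -> : (\prod_j P (E j) = \prod_(i < #|J|) P (E (enum_val i)))%E.
  by apply: reindex; apply: onW_bij; exact: enum_val_bij.
move=> <-; congr (P _); apply/seteqP; split=> [w Ew i _|w Ew j _]; first exact: Ew.
by rewrite -(enum_rankK j); exact: Ew.
Qed.

Variables (I : Type) (F : I -> set (set T)) (n : nat) (iota : nat -> 'I_n -> I).
Hypothesis FsigmaT : forall a, F a setT.
Hypothesis FI : forall a, setI_closed (F a).
Hypothesis Fmeasurable : forall a, F a `<=` measurable.
Hypothesis iota_inj : forall b i b' i', iota b i = iota b' i' -> (b, i) = (b', i').
Hypothesis indep : mutually_independent P F.

(** The sigma-algebras are revealed in batches of [n], in the order [iota]. The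
    rectangles over the first [K] batches are a pi-system for what is known then. *)
Definition past_rectangle (K : nat) : set (set T) :=
  [set D | exists2 E : 'I_K -> 'I_n -> set T,
     (forall (b : 'I_K) i, F (iota b i) (E b i)) & D = \bigcap_b \bigcap_i E b i].

(** The sample space, seen through the past only: measurability of a map on this
    type is measurability with respect to the past. *)
Definition past_type (K : nat) : measurableType _ :=
  g_sigma_algebraType (past_rectangle K).

Lemma past_rectangle_measurable K : past_rectangle K `<=` measurable.
Proof.
move=> _ [E FE ->].
by apply: fin_bigcap_measurable => // b _; apply: fin_bigcap_measurable => // i _;
  apply: Fmeasurable; exact: FE.
Qed.

Lemma past_measurable K : <<s past_rectangle K >> `<=` @measurable _ T.
Proof.
apply: smallest_sub; first exact: sigma_algebra_measurable.
exact: past_rectangle_measurable.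
Qed.

Lemma past_rectangleT K : past_rectangle K setT.
Proof. by exists (fun _ _ => setT) => //; apply/seteqP; split. Qed.

Lemma past_rectangleI K : setI_closed (past_rectangle K).
Proof.
move=> _ _ [E FE ->] [E' FE' ->]; exists (fun b i => E b i `&` E' b i).
  by move=> b i; apply: FI.
apply/seteqP; split=> [w [Ew E'w] b _ i _|w EE'w].
  by split; [exact: Ew|exact: E'w].
by split=> b _ i _; have [] := EE'w b Logic.I i Logic.I.
Qed.

Lemma past_batch (K : nat) b i : (b < K)%N -> F (iota b i) `<=` past_rectangle K.
Proof.
move=> bK A FA.
exists (fun b' i' => if (val b' == b) && (i' == i) then A else setT) => [b' i'|].
  by case: ifP => // /andP[/eqP -> /eqP ->].
apply/seteqP; split=> [w Aw b' _ i' _|w /(_ (Ordinal bK) Logic.I i Logic.I) /=].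
  by case: ifP.
by rewrite !eqxx.
Qed.

(** For a rectangle [D] of the past this is the product rule; both sides are
    finite measures in [D], so it extends from that pi-system to the whole past. *)
Lemma past_indep K D (C : 'I_n -> set T) :
  <<s past_rectangle K >> D -> (forall i, F (iota K i) (C i)) ->
  P (D `&` \bigcap_i C i) = (P D * \prod_i P (C i))%E.
Proof.
move=> sD FC.
have mC : measurable (\bigcap_i C i).
  by apply: fin_bigcap_measurable => // i _; apply: Fmeasurable; exact: FC.
have PC : P (\bigcap_i C i) = (\prod_i P (C i))%E.
  apply: (mutually_independent_fin indep (f := fun i => iota K i)) => //.
  by move=> i j /iota_inj[].
rewrite -PC.
pose c : {nonneg R} := NngNum (fine_ge0 (measure_ge0 P (\bigcap_i C i))).
have cE : c%:num%:E = P (\bigcap_i C i) by rewrite /= fineK// fin_num_measure.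
suff : mrestr P mC D = mscale c P D by rewrite /mrestr /mscale/= => ->; rewrite cE muleC.
apply: (@g_sigma_algebra_measure_unique _ R T (past_rectangle K)
  (@past_rectangle_measurable K) (fun=> setT)) => //.
- by move=> _; exact: past_rectangleT.
- by apply/seteqP; split=> // x _; exists 0%N.
- exact: past_rectangleI.
- move=> _ [E FE ->]; rewrite /mrestr /mscale [X in _ = (X * _)%E]cE PC.
  pose E' (x : 'I_K.+1 * 'I_n) := if unlift ord_max x.1 is Some b then E b x.2 else C x.2.
  have E'l b i : E' (lift ord_max b, i) = E b i by rewrite /E' /= liftK.
  have E'm i : E' (ord_max, i) = C i by rewrite /E' /= unlift_none.
  have E'w (b : 'I_K) i : E' (widen_ord (leqnSn K) b, i) = E b i.
    rewrite -E'l; congr (E' (_, _)); apply/val_inj; rewrite /= /bump.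
    by rewrite leqNgt ltn_ord.
  have FE' (x : 'I_K.+1 * 'I_n) : F (iota x.1 x.2) (E' x).
    case: x => b i /=; case: (unliftP ord_max b) => [b'|] ->.
      by rewrite E'l /= /bump leqNgt ltn_ord; exact: FE.
    by rewrite E'm; exact: FC.
  have inj (x y : 'I_K.+1 * 'I_n) : iota x.1 x.2 = iota y.1 y.2 -> x = y.
    by case: x y => [b i] [b' i'] /= /iota_inj[/val_inj -> ->].
  have := mutually_independent_fin indep inj FE'.
  rewrite -(pair_bigA _ (fun b i => P (E' (b, i)))) /= big_ord_recr /=.
  have -> : (\prod_(i < n) P (E' (ord_max, i)) = \prod_i P (C i))%E.
    by apply: eq_bigr => i _; rewrite E'm.
  have -> : (\prod_(b < K) \prod_(i < n) P (E' (widen_ord (leqnSn K) b, i)) =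
      P (\bigcap_b \bigcap_i E b i))%E.
    transitivity (\prod_(b < K) \prod_(i < n) P (E b i))%E.
      by apply: eq_bigr => b _; apply: eq_bigr => i _; rewrite E'w.
    rewrite (pair_bigA _ (fun b i => P (E b i))) /=.
    rewrite -(mutually_independent_fin indep
      (f := fun x : 'I_K * 'I_n => iota x.1 x.2) (E := fun x => E x.1 x.2)) //.
    + congr (P _); apply/seteqP; split=> [w Ew b _ i _|w Ew [b i] _].
        exact: (Ew (b, i)).
      exact: Ew.
    + by case=> [b i] [b' i'] /= /iota_inj[/val_inj -> ->].
  move=> E'E; apply: etrans (etrans _ E'E) (muleC _ _); congr (P _).
  apply/seteqP; split=> [w [Ew Cw] [b i] _|w E'w'].
    case: (unliftP ord_max b) => [b'|] ->; first by rewrite E'l; exact: Ew.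
    by rewrite E'm; exact: Cw.
  split=> [b _ i _|i _]; first by rewrite -E'l; exact: E'w'.
  by rewrite -E'm; exact: E'w'.
- move=> _; apply: le_lt_trans (ltry (1 : R)).
  exact: probability_le1 (measurableI _ _ measurableT mC).
Qed.

(** The conditional law of a function of the past and of an independent variable
    is obtained by freezing the past: on the sigma-algebra of the past, the pair
    of the identity and [V] has a product law. *)
Lemma past_freeze K d1 d2 (S1 : measurableType d1) (S2 : measurableType d2)
    (S : past_type K -> S1) (V : T -> S2) (Q : probability S2 R)
    (D : set T) (E : set (S1 * S2)) :
  measurable_fun setT S -> measurable_fun setT V ->
  (forall D B, <<s past_rectangle K >> D -> measurable B ->
     P (D `&` V @^-1` B) = (P D * Q B)%E) ->
  <<s past_rectangle K >> D -> measurable E ->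
  P (D `&` [set w | E (S w, V w)]) = (\int[P]_(w in D) Q [set v | E (S w, v)])%E.
Proof.
move=> mS mV VE sD mE.
have mid : measurable_fun setT (idfun : T -> past_type K).
  by move=> _ A mA; rewrite setTI; exact: (@past_measurable K A mA).
pose P' := image_prob P mid.
have mV' : measurable_fun setT (fun w : T => (w : past_type K, V w)).
  by apply/measurable_fun_pair.
have joint (X : set (past_type K * S2)) : measurable X ->
    (P' \x Q)%E X = P [set w | X (w, V w)].
  by move=> mX; rewrite (product_measure_unique (m' := image_prob P mV')).
pose X := [set z : past_type K * S2 | D z.1 /\ E (S z.1, z.2)].
have mX : measurable X.
  apply: measurableI.
    rewrite -[X in measurable X]setTI; apply: measurable_fst => //; exact: sD.
  rewrite -[X in measurable X]setTI.
  have mSE : measurable_fun setT (fun z : past_type K * S2 => (S z.1, z.2)).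
    apply/measurable_fun_pair => /=; last exact: measurable_snd.
    by apply: (measurableT_comp mS); exact: measurable_fst.
  exact: mSE.
rewrite -[LHS](joint X mX) /product_measure1.
have mQ : measurable_fun setT (Q \o xsection X) by exact: measurable_fun_xsection.
rewrite (ge0_integral_pushforward mid)//.
rewrite [RHS]integral_mkcond; apply: eq_integral => w _ /=.
rewrite patchE; case: ifPn => [|] wD.
  congr (Q _); apply/seteqP; split=> v; rewrite /xsection /= inE.
    by case.
  by move=> Ev; split => //; exact: set_mem.
rewrite (_ : xsection X w = set0) ?measure0//.
apply/seteqP; split=> v //; rewrite /xsection /= inE => -[/= Dw _].
by move: wD; rewrite notin_setE => /(_ Dw).
Qed.

End independence.

(** * Gaussian and Wishart laws *)

Section gaussian_and_wishart_laws.
Context {R : realType}.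

(** The product rule over the whole finite family implies the rule over its
    subfamilies: the sets of the missing members are taken to be the whole space. *)
Lemma independent_of_rectangles d (T : measurableType d) (Q : probability T R)
    (J : finType) d' (S : measurableType d') (X : J -> T -> S) :
  (forall C : J -> set S, (forall j, measurable (C j)) ->
    Q (\bigcap_j (X j @^-1` C j)) = (\prod_j Q (X j @^-1` C j))%E) ->
  mutually_independent Q (fun j => g_sigma_algebra_preimage (X j)).
Proof.
move=> rect k f E f_inj XE.
have [C CE] : exists C : 'I_k -> set S,
    forall i, measurable (C i) /\ E i = X (f i) @^-1` C i.
  have h i : exists B, measurable B /\ E i = X (f i) @^-1` B.
    by have [B mB <-] := XE i; exists B; split; rewrite ?setTI.
  by have [C CP] := choice h; exists C.
pose C' j := if [pick i | f i == j] is Some i then C i else setT.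
have C'f i : C' (f i) = C i.
  rewrite /C'; case: pickP => [i' /eqP/f_inj -> //|/(_ i)].
  by rewrite eqxx.
have mC' j : measurable (C' j).
  by rewrite /C'; case: pickP => // i _; have [] := CE i.
have C'n j : j \notin f @: [set: 'I_k]%SET -> C' j = setT.
  move=> jf; rewrite /C'; case: pickP => // i /eqP fij.
  by move: jf; rewrite -fij imset_f// inE.
have -> : \bigcap_i E i = \bigcap_j (X j @^-1` C' j).
  apply/seteqP; split=> [w Ew j _ /=|w Cw i _].
    have [/imsetP[i _ ->]|/C'n -> //] := boolP (j \in f @: [set: 'I_k]%SET).
    by rewrite C'f; have := Ew i Logic.I; rewrite (CE i).2.
  by rewrite (CE i).2 /= -C'f; exact: Cw.
rewrite rect// (bigID (mem (f @: [set: 'I_k]%SET))) /=.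
rewrite [X in (_ * X)%E]big1 ?mule1; last first.
  by move=> j /C'n ->; rewrite preimage_setT probability_setT.
rewrite big_imset /=; last by move=> i j _ _; exact: f_inj.
apply: eq_big => [i|i _]; first by rewrite inE.
by rewrite C'f (CE i).2.
Qed.

Lemma gauss_column k n (j : 'I_n) (C : set 'cV[R]_k) : measurable C ->
  gauss k n [set M | C (col j M)] = gauss k 1 C.
Proof.
move=> mC; pose D l := if l == j then C else setT.
have mD l : measurable (D l) by rewrite /D; case: ifP.
rewrite (_ : [set M | _] = [set M : 'M[R]_(k, n) | forall l, D l (col l M)]).
  rewrite gauss_columns// (bigD1 j)//= {1}/D eqxx big1 ?mule1// => l /negbTE lj.
  by rewrite /D lj probability_setT.
apply/seteqP; split=> [M CM l|M DM]; rewrite /D /=; first by case: eqP => // ->.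
by have := DM j; rewrite /D eqxx.
Qed.

Lemma gauss_entry k (i : 'I_k) (C : set R) : measurable C ->
  gauss k 1 [set G | C (G i 0)] = normal_prob 0 1 C.
Proof.
move=> mC; pose D l (_ : 'I_1) := if l == i then C else setT.
have mD l j : measurable (D l j) by rewrite /D; case: ifP.
transitivity (gauss k 1 [set G | forall l j, D l j (G l j)]); last first.
  rewrite gauss_rectangle// (bigD1 i)//= big_ord1 {1}/D eqxx big1 ?mule1//.
  by move=> l /negbTE li; rewrite big_ord1 /D li probability_setT.
congr (gauss k 1 _); apply/seteqP; split=> [G CG l j|G DG]; rewrite /D /=.
  by rewrite ord1; case: eqP => // ->.
by have := DG i 0; rewrite /D eqxx.
Qed.

(** A Gaussian law can be sampled with any factor of its covariance, not just with
    the one it was defined by. *)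
Lemma gaussian_law_gauss d (m : 'cV[R]_d) (Sigma : 'M[R]_d) mu k (L : 'M[R]_(d, k))
    (C : set 'cV[R]_d) :
  gaussian_law m Sigma mu -> L *m L^T = Sigma -> measurable C ->
  mu C = gauss k 1 [set G | C (m + L *m G)].
Proof.
move=> [k' [L' [disp [T [Q [G [LL' indep normG muE]]]]]]] LL mC.
have mmL k0 (L0 : 'M[R]_(d, k0)) :
    measurable [set G : 'cV[R]_k0 | C (m + L0 *m G)].
  apply: (measurable_preimageT (f := fun G => m + L0 *m G)) => //.
  apply: measurable_fun_mxD; [exact: measurable_cst|exact: measurable_mulmxr].
have mG : measurable_fun setT G by [].
have GE B : measurable B -> Q [set w | B (G w)] = gauss k' 1 B.
  move=> mB; rewrite -(gauss_unique (mu := image_prob Q mG))// => D mD.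
  transitivity (Q (\bigcap_i ((fun w => G w i 0) @^-1` D i 0))).
    congr (Q _); apply/seteqP; split=> [w Dw i _|w Dw i j]; first exact: Dw.
    by rewrite ord1; exact: Dw.
  rewrite (indep _ id)//; last first.
    by move=> i; exists (D i 0) => //; rewrite setTI.
  by apply: eq_bigr => i _; rewrite big_ord1; exact: (normG i (D i 0) (mD i 0)).
rewrite muE// (GE _ (mmL _ L')).
apply: (gauss_mulmx_law (A := [set M | C (m + M)])); first by rewrite LL.
apply: (measurable_preimageT (f := fun M => m + M)) => //.
by apply: measurable_fun_mxD; [exact: measurable_cst|exact: measurable_id].
Qed.

Lemma gauss_gaussian_law d k (L : 'M[R]_(d, k)) mu :
  (forall C, measurable C -> mu C = gauss k 1 [set G | C (L *m G)]) ->
  gaussian_law 0 (L *m L^T) mu.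
Proof.
move=> muE; exists k, L, _, _, (gauss k 1).
exists (random_variable_of (gauss k 1) (@measurable_id _ _ setT)).
split=> // [|i C mC|C mC].
- apply: independent_of_rectangles => C mC.
  transitivity (gauss k 1 [set G | forall i j, C i (G i j)]).
    congr (gauss k 1 _); apply/seteqP; split=> [G CG i j|G CG i _]; last exact: CG.
    by rewrite ord1; exact: CG.
  rewrite (gauss_rectangle (fun i _ => mC i)); apply: eq_bigr => i _.
  by rewrite big_ord1; exact: (esym (gauss_entry i (mC i))).
- exact: gauss_entry.
- rewrite muE//; congr (gauss k 1 _).
  by apply/seteqP; split=> G /=; rewrite add0r.
Qed.

(** Both sides are finite measures in [A]; on a rectangle, the left one factors over
    the columns by hypothesis, and the right one because the columns of a Gaussian
    matrix are independent. *)
Lemma columns_law d (T : measurableType d) (P : probability T R) (D : set T)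
    m n k (L : 'M[R]_(m, k)) (mean : 'cV[R]_m) (V : 'I_n -> T -> 'cV[R]_m) :
  measurable D -> (forall j, measurable_fun setT (V j)) ->
  (forall C : 'I_n -> set 'cV[R]_m, (forall j, measurable (C j)) ->
    P (D `&` \bigcap_j V j @^-1` C j) = (P D * \prod_j P (V j @^-1` C j))%E) ->
  (forall j C, measurable C ->
    P (V j @^-1` C) = gauss k 1 [set G | C (mean + L *m G)]) ->
  forall A, measurable A ->
  P (D `&` [set w | A (\matrix_(i, j) V j w i 0)]) =
  (P D * gauss k n [set G | A (mean *m const_mx 1 + L *m G)%R])%E.
Proof.
move=> mD mV indep lawV A mA.
have mX : measurable_fun setT (fun w => \matrix_(i, j) V j w i 0 : 'M[R]_(m, n)).
  apply/measurable_fun_mxP => i j; under eq_fun do rewrite mxE.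
  exact: (proj1 (measurable_fun_mxP _) (mV j)).
have mY : measurable_fun setT
    (fun G : 'M[R]_(k, n) => mean *m const_mx 1 + L *m G).
  by apply: measurable_fun_mxD; [exact: measurable_cst|exact: measurable_mulmxr].
(* the image of the restriction of [P] to [D] *)
pose m1 := measure_function_pushforward__canonical__measure_function_Measure (mrestr P mD) mX.
pose c : {nonneg R} := NngNum (fine_ge0 (measure_ge0 P D)).
have cE : c%:num%:E = P D by rewrite /= fineK// fin_num_measure.
pose m2 := mscale c (image_prob (gauss k n) mY).
suff : m1 A = m2 A.
  by rewrite /m2 /mscale /= cE => <-; rewrite setIC.
apply: mx_measure_unique => //.
  apply: le_lt_trans (ltry (1 : R)).
  exact: probability_le1 (measurableI _ _ measurableT mD).
move=> C mC; rewrite /m2 /mscale [X in _ = (X * _)%E]cE.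
pose C' j := [set x : 'cV[R]_m | forall i l, (fun i _ => C i j) i l (x i l)].
have mC' j : measurable (C' j) by apply: measurable_entry_rectangle => i _.
transitivity (P (D `&` \bigcap_j V j @^-1` C' j)).
  rewrite setIC; congr (P (_ `&` _)); apply/seteqP; split=> [w Cw j _ i l|w Cw i j].
    by rewrite ord1; have := Cw i j; rewrite mxE.
  by rewrite mxE; exact: Cw.
rewrite indep//; congr (_ * _)%E.
pose C'' j := [set x : 'cV[R]_k | C' j (mean + L *m x)].
have mC'' j : measurable (C'' j).
  apply: (measurable_preimageT (f := fun x => mean + L *m x)) => //.
  by apply: measurable_fun_mxD; [exact: measurable_cst|exact: measurable_mulmxr].
transitivity (gauss k n [set G | forall j, C'' j (col j G)]).
  by rewrite gauss_columns//; apply: eq_bigr => j _; exact: lawV.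
have colE G i j : (mean *m const_mx 1 + L *m G : 'M[R]_(m, n)) i j =
    (mean + L *m col j G) i 0.
  by rewrite !mxE big_ord1 mxE mulr1; congr (_ + _); apply: eq_bigr => l _; rewrite mxE.
congr (gauss k n _); apply/seteqP; split=> [G CG i j|G CG j i l].
  by rewrite colE; exact: CG.
by rewrite ord1 -colE; exact: CG.
Qed.

End gaussian_and_wishart_laws.

(** * A measurable square root *)

Section cholesky.
Context {R : realType}.
Implicit Types d n : nat.

Let mulmx_delta m n (A : 'M[R]_(m, n)) i k (j : 'I_1) :
  (A *m delta_mx i j) k j = A k i.
Proof.
rewrite mxE (bigD1 i)//= big1 => [|l /negbTE li]; rewrite mxE ?eqxx ?mulr1 ?addr0//.
by rewrite li mulr0.
Qed.

Let mulmx_deltaT m n (A : 'M[R]_(m, n)) i k (j : 'I_1) :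
  ((delta_mx i j)^T *m A) j k = A i k.
Proof.
rewrite mxE (bigD1 i)//= big1 => [|l /negbTE li].
  by rewrite !mxE !eqxx mul1r addr0.
by rewrite !mxE li mul0r.
Qed.

Lemma possemidefmx_block d (a : R) (b : 'cV[R]_d) (C : 'M[R]_d) (t : R) (x : 'cV[R]_d) :
  possemidefmx (block_mx a%:M b^T b C) ->
  0 <= a * t ^+ 2 + (b^T *m x) 0 0 * t *+ 2 + (x^T *m C *m x) 0 0.
Proof.
move=> [_ /(_ (col_mx t%:M x))].
have xb : x^T *m b = b^T *m x.
  by rewrite [LHS]mx11_scalar -tr_scalar_mx -mx11_scalar trmx_mul trmxK.
rewrite tr_col_mx mul_row_block mul_row_col tr_scalar_mx.
rewrite !mul_scalar_mx mul_mx_scalar mulmxDl -scalemxAl xb.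
rewrite [b^T *m x]mx11_scalar [x^T *m C *m x]mx11_scalar.
rewrite !scale_scalar_mx -!raddfD /= scale_scalar_mx -!raddfD /= [X in 0 <= X]mxE.
rewrite eqxx mulr1n; set u := (b^T *m x) 0 0; set v := (x^T *m C *m x) 0 0.
rewrite [u%:M 0 0]mxE [v%:M 0 0]mxE eqxx !mulr1n.
by congr (0 <= _); ring.
Qed.

(** The Cholesky factor, with the conventions of division by zero: at a
    vanishing pivot the column is zero, and so is the column of a positive
    semi-definite matrix. *)
Fixpoint cholesky d n : 'M[R]_d -> 'M[R]_(d, n) :=
  match d, n return 'M[R]_d -> 'M[R]_(d, n) with
  | d'.+1, n'.+1 => fun S =>
      let M : 'M[R]_(1 + d') := S in
      let r := Num.sqrt (S 0 0) in
      (block_mx r%:M 0 (r^-1 *: dlsubmx M)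
        (cholesky n' (drsubmx M - (r^-1 *: dlsubmx M) *m (r^-1 *: dlsubmx M)^T))
        : 'M[R]_(1 + d', 1 + n'))
  | _, _ => fun _ => 0
  end.

Lemma measurable_cholesky dd (T : measurableType dd) d n (f : T -> 'M[R]_d) :
  measurable_fun setT f -> measurable_fun setT (fun w => cholesky n (f w)).
Proof.
elim: d n f => [|d IHd] [|n] f mf; do ?exact: measurable_cst.
pose g w : 'M[R]_(1 + d) := f w.
have mr : measurable_fun setT (fun w => Num.sqrt (f w 0 0)).
  by apply: measurable_fun_sqrt; exact: (proj1 (measurable_fun_mxP f) mf).
have mb : measurable_fun setT (fun w => (Num.sqrt (f w 0 0))^-1 *: dlsubmx (g w)).
  apply: measurable_fun_scalemx; first exact: measurable_funV.
  exact: measurable_fun_dlsubmx.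
apply: (measurable_fun_col_mx (m1 := 1) (m2 := d)).
  apply: (measurable_fun_row_mx (n1 := 1) (n2 := n)).
    exact: measurable_fun_scalar_mx.
  exact: measurable_cst.
apply: (measurable_fun_row_mx (n1 := 1) (n2 := n)) => //.
apply: IHd; apply: measurable_fun_mxB; first exact: measurable_fun_drsubmx.
by apply: measurable_fun_mulmx => //; exact: measurable_fun_trmx.
Qed.

(** Eliminate the first coordinate: the Schur complement is positive
    semi-definite, being the form minimised over that coordinate. *)
Lemma cholesky_gram d n (S : 'M[R]_d) : (d <= n)%N -> possemidefmx S ->
  cholesky n S *m (cholesky n S)^T = S.
Proof.
elim: d n S => [|d IHd] n S; first by rewrite [RHS]flatmx0 [LHS]flatmx0.
case: n => // n dn Spsd.
pose M : 'M[R]_(1 + d) := S; pose a := S 0 0.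
pose b : 'cV[R]_d := dlsubmx M; pose C : 'M[R]_d := drsubmx M.
have ME : M = block_mx a%:M b^T b C.
  rewrite -[LHS]submxK; congr block_mx.
    apply/matrixP => i j; rewrite !ord1 !mxE eqxx mulr1n /a /M.
    by congr (S _ _); exact/val_inj.
  by rewrite /b trmx_dlsub (proj1 Spsd : M^T = M).
have Mpsd : possemidefmx (block_mx a%:M b^T b C) by rewrite -ME.
have a0 : 0 <= a.
  have := possemidefmx_block 1 0 Mpsd.
  by rewrite mulmx0 trmx0 mul0mx mul0mx !mxE mul0r mul0rn !addr0 expr1n mulr1.
have CT : C^T = C by rewrite /C trmx_drsub (proj1 Spsd : M^T = M).
pose r := Num.sqrt a.
have rr : r * r = a by rewrite -expr2 sqr_sqrtr.
have rb : r *: (r^-1 *: b) = b.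
  have [r0|r0] := eqVneq r 0; last by rewrite scalerA mulfV// scale1r.
  rewrite r0 scale0r; apply/esym.
  have az : a = 0 by rewrite -rr r0 mulr0.
  apply/colP => i; rewrite [RHS]mxE.
  (* along [e_i] the form is affine in the first coordinate; were its slope not
     zero, it would take the value -1 at the point chosen here *)
  pose q := b i 0; pose e := C i i.
  have := possemidefmx_block (- (e + 1) / (q *+ 2)) (delta_mx i 0) Mpsd.
  have -> : (b^T *m (delta_mx i 0 : 'cV[R]_d)) 0 0 = q.
    by rewrite mulmx_delta mxE.
  have -> : ((delta_mx i 0 : 'cV[R]_d)^T *m C *m (delta_mx i 0 : 'cV[R]_d)) 0 0 = e.
    by rewrite mulmx_delta mulmx_deltaT.
  rewrite az mul0r add0r => h; apply/eqP; apply: contraLR h => q0.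
  rewrite -ltNge -mulrnAl mulrC mulfVK; last by rewrite mulrn_eq0.
  by rewrite opprD addrAC addNr add0r oppr_lt0.
pose c := r^-1 *: b.
have Cpsd : possemidefmx (C - c *m c^T).
  split; first by rewrite linearB /= trmx_mul trmxK CT.
  (* the minimiser of the form over the first coordinate *)
  move=> x; pose t := - r^-1 * (c^T *m x) 0 0.
  have := possemidefmx_block t x Mpsd.
  have bc : (b^T *m x) 0 0 = r * (c^T *m x) 0 0.
    by rewrite -[in LHS]rb linearZ /= -scalemxAl mxE.
  have xcc : (x^T *m (c *m c^T) *m x) 0 0 = (c^T *m x) 0 0 ^+ 2.
    have -> : x^T *m (c *m c^T) *m x = (c^T *m x)^T *m (c^T *m x).
      by rewrite trmx_mul trmxK !mulmxA.
    by rewrite [LHS]mxE big_ord1 !mxE expr2.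
  have -> : (x^T *m (C - c *m c^T) *m x) 0 0 =
      (x^T *m C *m x) 0 0 - (x^T *m (c *m c^T) *m x) 0 0.
    by rewrite mulmxBr mulmxBl [LHS]mxE [X in _ + X]mxE.
  rewrite bc xcc; set s := (c^T *m x) 0 0; set v := (x^T *m C *m x) 0 0.
  have [r0|r0] := eqVneq r 0.
    rewrite -rr r0 !(mul0r, mul0rn, add0r) /s /c r0 invr0 scale0r trmx0 mul0mx.
    by rewrite [X in _ - X ^+ 2]mxE expr0n subr0.
  congr (0 <= _); rewrite -rr /t -/s.
  by field.
have IH := IHd n _ dn Cpsd.
pose F := block_mx r%:M (0 : 'rV[R]_n) c (cholesky n (C - c *m c^T)).
suff : F *m F^T = M by [].
rewrite /F tr_block_mx mulmx_block.
rewrite IH trmx0 !mulmx0 !mul0mx !addr0 tr_scalar_mx -scalar_mxM rr.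
rewrite mul_scalar_mx mul_mx_scalar -linearZ /= rb [c *m _ + _]addrC subrK.
by rewrite [RHS]ME.
Qed.

End cholesky.

(** * Reduction of the sample covariance *)

Section sample_covariance.
Context {R : realType}.

(** Rotating the all-ones row to an axis and dropping that axis gives [N] contrast
    columns (a Helmert matrix): they kill the constants, and they map Gaussian
    matrices to Gaussian matrices. *)
Lemma helmert_exists (N : nat) : exists U : 'M[R]_(N.+1, N),
  [/\ (const_mx 1 : 'rV[R]_N.+1) *m U = 0,
      U^T *m U = 1%:M,
      U *m U^T = 1%:M - N.+1%:R^-1 *: const_mx 1 &
      forall k (A : set 'M[R]_(k, N)), measurable A ->
        gauss k N.+1 [set G | A (G *m U)] = gauss k N A].
Proof.
pose e : 'rV[R]_N.+1 := const_mx 1.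
have [ O [ OO inv eO]] := rotate_row_to_axis e.
have ee : (e *m e^T) 0 0 = N.+1%:R.
  rewrite mxE (eq_bigr (fun=> 1)) ?sumr_const ?card_ord// => j _.
  by rewrite !mxE mulr1.
rewrite ee in eO; set r := Num.sqrt _ in eO.
have rr : r * r = N.+1%:R by rewrite -expr2 sqr_sqrtr.
have r0 : r != 0 by rewrite gt_eqF// sqrtr_gt0 ltr0Sn.
pose O1 : 'M[R]_(N.+1, 1 + N) := O.
pose o := lsubmx O1; pose U := rsubmx O1.
have OE : O1 = row_mx o U by rewrite hsubmxK.
have eOE : e *m O1 = row_mx r%:M 0 := eO.
have /eq_row_mx[eo eU] : row_mx (e *m o) (e *m U) = row_mx r%:M 0.
  by rewrite -mul_mx_row -OE.
have OTO : O1^T *m O1 = 1%:M by exact: mulmx1C OO.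
have OOT : O1 *m O1^T = 1%:M by exact: OO.
exists U; split=> //.
- move: OTO; rewrite OE tr_row_mx mul_col_row scalar_mx_block.
  by move=> /eq_block_mx[].
- have oE : o = r^-1 *: e^T.
    have : O1 *m (e *m O1)^T = e^T by rewrite trmx_mul mulmxA OOT mul1mx.
    rewrite eOE OE tr_row_mx mul_row_col trmx0 mulmx0 addr0 tr_scalar_mx.
    by rewrite mul_mx_scalar => <-; rewrite scalerA mulVf// scale1r.
  move: OOT; rewrite OE tr_row_mx mul_row_col => /(canRL (addKr _)) ->.
  rewrite oE linearZ /= -scalemxAl -scalemxAr scalerA -invfM rr trmxK addrC.
  congr (_ - _ *: _); apply/matrixP => i j.
  by rewrite mxE big_ord1 !mxE mulr1.
- move=> k A mA.
  rewrite -[LHS](_ : gauss k N.+1 [set G | A (rsubmx (G *m O1))] = _); last first.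
    congr (gauss k N.+1 _); apply/seteqP; split=> G /=;
      by rewrite OE mul_mx_row row_mxKr.
  have mrs : measurable [set M : 'M[R]_(k, 1 + N) | A (rsubmx M)].
    apply: (measurable_preimageT (f := fun M : 'M[R]_(k, 1 + N) => rsubmx M)) => //.
    by apply: measurable_fun_rsubmx; exact: measurable_id.
  rewrite [LHS](inv k _ mrs) [LHS](@gauss_row_mx R k 1 N _ mrs).
  transitivity ((gauss k 1 \x gauss k N)%E (setT `*` A)).
    congr (product_measure1 _ _ _); apply/seteqP; split=> -[M M'] /=;
      by rewrite row_mxKr => // -[].
  rewrite product_measure1E// -[RHS]mul1e; congr (_ * _)%E.
  exact: probability_setT.
Qed.

Definition ensemble_mx d N (x : ensemble R d N) : 'M[R]_(d, N.+1) :=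
  \matrix_(i, j) x j i 0.

Definition gram_mx d N (S : 'M[R]_(d, N)) : 'M[R]_d := N%:R^-1 *: (S *m S^T).

(** [U *m U^T] is the centering projection, so that the centred ensemble and the
    contrasts have the same Gram matrix. *)
Lemma sample_cov_gram d N (x : ensemble R d N) (U : 'M[R]_(N.+1, N)) :
  U^T *m U = 1%:M -> U *m U^T = 1%:M - N.+1%:R^-1 *: const_mx 1 ->
  sample_cov x = gram_mx (ensemble_mx x *m U).
Proof.
move=> UTU UUT; rewrite /sample_cov /gram_mx; congr (_ *: _).
pose X := ensemble_mx x; pose C := X *m (U *m U^T).
have colC j : x j - sample_mean x = col j C.
  have CE : C = X - N.+1%:R^-1 *: (X *m const_mx 1).
    by rewrite /C UUT mulmxBr mulmx1 -scalemxAr.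
  apply/colP => i; rewrite CE /sample_mean !mxE summxE; congr (_ - _ * _).
  by apply: eq_bigr => l _; rewrite !mxE mulr1.
under eq_bigr do rewrite colC.
transitivity (C *m C^T).
  apply/matrixP => i k; rewrite summxE mxE; apply: eq_bigr => j _.
  by rewrite mxE big_ord1 !mxE.
rewrite /C !trmx_mul trmxK -!mulmxA; congr (_ *m (_ *m _)).
by rewrite !mulmxA UTU mul1mx.
Qed.

End sample_covariance.

(** * Almost sure positive definiteness *)

Section nonvanishing.
Context {R : realType}.

(** A coordinate-free way of being a polynomial function of the entries, stable
    under the partial evaluations of the induction below. *)
Definition poly_on_lines (V : lmodType R) (f : V -> R) : Prop :=
  forall x y, exists q : {poly R}, forall t, f (x + t *: y) = q.[t].

Lemma std_normal_roots (q : {poly R}) :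
  q != 0 -> @std_normal R [set t | q.[t] = 0] = 0%E.
Proof.
move=> q0.
have fin : finite_set [set t : R | q.[t] = 0].
  apply: contrapT => /(infinite_set_fset (size q))[B Bq sB].
  have rB : all (root q) (finmap.enum_fset B) by apply/allP => t tB; apply/eqP/Bq.
  by have := max_poly_roots q0 rB (finmap.fset_uniq B); rewrite ltnNge sB.
have cnt := finite_set_countable fin.
have /null_content_dominatesP dom := @normal_prob_dominates R 0 1.
apply: dom; first exact: countable_measurable.
exact: countable_lebesgue_measure0.
Qed.

(** Fubini: with the first coordinate frozen at that of [x0], [f] is almost surely
    nonzero in the others by induction; each such choice of the others leaves a
    nonzero polynomial in the first coordinate, with finitely many roots. *)
Lemma gauss_row_nonvanishing n (f : 'rV[R]_n -> R) (x0 : 'rV[R]_n) :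
  measurable_fun setT f -> poly_on_lines f -> f x0 != 0 ->
  gauss_row n [set x | f x = 0] = 0%E.
Proof.
elim: n f x0 => [|n IHn] f x0 mf fpoly fx0.
  rewrite (_ : [set x | _] = set0) ?measure0//.
  by apply/seteqP; split=> // x /eqP; rewrite (thinmx0 x) -(thinmx0 x0) (negbTE fx0).
pose cons (a : R) (v : 'rV[R]_n) : 'rV[R]_n.+1 := row_mx a%:M v.
have cons_lin a b x y (t : R) : cons a x + t *: cons b y = cons (a + t * b) (x + t *: y).
  apply/rowP => j; rewrite mxE [X in _ + X]mxE.
  by case: (unliftP ord0 j) => [l|] ->; rewrite ?row_mx_lift ?row_mx_ord0 !mxE ?eqxx.
have [a0 [v0 x0E]] : exists a v, x0 = cons a v.
  exists (x0 0 0), (\row_l x0 0 (lift ord0 l)); apply/rowP => j.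
  by case: (unliftP ord0 j) => [l|] ->; rewrite (row_mx_lift, row_mx_ord0) mxE.
have mcons : measurable_fun setT (fun z : R * 'rV[R]_n => f (cons z.1 z.2)).
  exact: (measurableT_comp mf (@measurable_row_cons R n)).
have mcons0 : measurable_fun setT (fun v => f (cons a0 v)).
  have mrow : measurable_fun setT (fun v : 'rV[R]_n => (a0, v)).
    by apply/measurable_fun_pair.
  exact: (measurableT_comp mcons mrow).
have zero (d : measure_display) (T : measurableType d) (g : T -> R) :
    measurable_fun setT g -> measurable [set x | g x = 0].
  move=> mg; apply: (measurable_preimageT (f := g) (A := [set 0])) => //.
pose B1 := [set v | f (cons a0 v) = 0].
have mB1 : measurable B1.
  exact: zero.
have B10 : gauss_row n B1 = 0%E.
  apply: (IHn _ v0); last by rewrite -/(cons _ _) -x0E.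
    exact: mcons0.
  move=> x y; have [q qE] := fpoly (cons a0 x) (cons 0 y).
  by exists q => t; rewrite -qE cons_lin mulr0 addr0.
pose B2 := [set z : R * 'rV[R]_n | f (cons z.1 z.2) = 0] `\` (setT `*` B1).
have mB2 : measurable B2 by apply: measurableD; [exact: zero|exact: measurableX].
have B20 : (@std_normal R \x gauss_row n)%E B2 = 0%E.
  rewrite (product_measure_unique (m' := (@std_normal R \x^ gauss_row n)%E))//; last first.
    by move=> X Y mX mY; exact: product_measure2E.
  apply: integral0_eq => v _ /=.
  have [fv|fv] := eqVneq (f (cons a0 v)) 0.
    rewrite (_ : ysection B2 v = set0) ?measure0//.
    apply/seteqP; split=> // t; rewrite /ysection /= inE => -[/= _ nB1].
    by apply: nB1; split.
  have [q qE] := fpoly (cons 0 v) (cons 1 0).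
  have consE t : f (cons t v) = q.[t].
    by rewrite -qE cons_lin add0r mulr1 scaler0 addr0.
  have q0 : q != 0 by apply: contra_neq fv => q0; rewrite consE q0 horner0.
  rewrite (_ : ysection B2 v = [set t | q.[t] = 0]); first exact: std_normal_roots.
  apply/seteqP; split=> t; rewrite /ysection /= inE -consE; first by case.
  by move=> ftv; split => // -[_ /eqP]; rewrite (negbTE fv).
have B1x0 : (@std_normal R \x gauss_row n)%E (setT `*` B1) = 0%E.
  apply: etrans (product_measure1E _ _ measurableT mB1) _.
  exact: etrans (congr1 (mule _) B10) (mule0 _).
rewrite gauss_rowS.
apply: (subset_measure0 (B := (setT `*` B1) `|` B2)).
- exact: zero.
- by apply: measurableU => //; exact: measurableX.
- move=> z fz; have [?|?] := pselect ((setT `*` B1) z); [by left|by right].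
apply/eqP; rewrite eq_le measure_ge0 andbT.
apply: (le_trans (measureU2 _ _ _)) => //; first exact: measurableX.
rewrite [leLHS](_ : _ = 0%E)// -[RHS]adde0.
by congr (_ + _)%E; [exact: B1x0|exact: B20].
Qed.

Lemma gauss_nonvanishing k n (f : 'M[R]_(k, n) -> R) (G0 : 'M[R]_(k, n)) :
  measurable_fun setT f -> poly_on_lines f -> f G0 != 0 ->
  gauss k n [set G | f G = 0] = 0%E.
Proof.
move=> mf fpoly fG0.
apply: (gauss_row_nonvanishing (f := f \o vec_mx) (x0 := mxvec G0)) => /=.
- exact: (measurableT_comp mf (@measurable_vec_mx R k n)).
- move=> x y; have [q qE] := fpoly (vec_mx x) (vec_mx y).
  by exists q => t; rewrite -qE /= linearD linearZ.
- by rewrite mxvecK.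
Qed.

Lemma det_gram_poly_on_lines d n k (z : 'M[R]_(d, n)) (L : 'M[R]_(d, k)) :
  poly_on_lines (fun G : 'M[R]_(k, n) => \det ((z + L *m G) *m (z + L *m G)^T)).
Proof.
move=> x y.
pose M (A C : 'M[R]_(d, n)) : 'M[{poly R}]_(d, n) :=
  map_mx polyC A + 'X *: map_mx polyC C.
have ME A C t : A + t *: C = map_mx (horner_eval t) (M A C).
  by apply/matrixP => i j; rewrite !mxE horner_evalE !hornerE.
exists (\det (M (z + L *m x) (L *m y) *m (M (z + L *m x) (L *m y))^T)) => t.
rewrite mulmxDr addrA -scalemxAr ME.
by rewrite matrix.map_trmx -map_mxM det_map_mx.
Qed.

(** A single value of the noise at which the rows are independent is enough. *)
Lemma gauss_gram_unit d n k (z : 'M[R]_(d, n)) (L : 'M[R]_(d, k)) G0 :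
  (z + L *m G0) *m (z + L *m G0)^T \in unitmx ->
  gauss k n [set G | ~ ((z + L *m G) *m (z + L *m G)^T \in unitmx)] = 0%E.
Proof.
rewrite unitmxE unitfE => G0u.
rewrite -(gauss_nonvanishing _ (det_gram_poly_on_lines z L) G0u).
  congr (gauss k n _); apply/seteqP; split=> G /=; rewrite unitmxE unitfE.
    by move=> /negP; rewrite negbK => /eqP.
  by move=> ->; rewrite eqxx.
apply: measurable_fun_det; apply: measurable_fun_mulmx.
  by apply: measurable_fun_mxD; [exact: measurable_cst|exact: measurable_mulmxr].
apply: measurable_fun_trmx.
by apply: measurable_fun_mxD; [exact: measurable_cst|exact: measurable_mulmxr].
Qed.

End nonvanishing.

Section definite_matrices.
Context {R : realType}.

Lemma posdefmx_unit d (M : 'M[R]_d) : posdefmx M -> M \in unitmx.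
Proof.
move=> [_ Mpos]; rewrite unitmxE unitfE; apply/negP => /det0P[v v0 vM].
have := Mpos v^T; rewrite trmxK vM mul0mx mxE ltxx.
by rewrite -(inj_eq trmx_inj) trmxK trmx0 => /(_ v0).
Qed.

Lemma possemidefmx_gram d n (S : 'M[R]_(d, n)) : possemidefmx (S *m S^T).
Proof.
split=> [|u]; first by rewrite trmx_mul trmxK.
have -> : u^T *m (S *m S^T) *m u = (u^T *m S) *m (u^T *m S)^T.
  by rewrite trmx_mul trmxK !mulmxA.
exact: gram_row_ge0.
Qed.

Lemma possemidefmx_scale d (a : R) (M : 'M[R]_d) :
  0 <= a -> possemidefmx M -> possemidefmx (a *: M).
Proof.
move=> a0 [MT M0]; split=> [|u]; first by rewrite linearZ /= MT.
by rewrite -scalemxAr -scalemxAl mxE mulr_ge0.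
Qed.

Lemma possemidefmx_congr d n (A : 'M[R]_(n, d)) (M : 'M[R]_d) :
  possemidefmx M -> possemidefmx (A *m M *m A^T).
Proof.
move=> [MT M0]; split=> [|u]; first by rewrite !trmx_mul trmxK MT mulmxA.
have -> : u^T *m (A *m M *m A^T) *m u = (A^T *m u)^T *m M *m (A^T *m u).
  by rewrite trmx_mul trmxK !mulmxA.
exact: M0.
Qed.

Lemma possemidefmx_gram_mx d n (S : 'M[R]_(d, n)) : possemidefmx (gram_mx S).
Proof.
by apply: possemidefmx_scale; [rewrite invr_ge0 ler0n|exact: possemidefmx_gram].
Qed.

Lemma posdefmx_gram_mx d n (S : 'M[R]_(d, n)) :
  (0 < n)%N -> S *m S^T \in unitmx -> posdefmx (gram_mx S).
Proof.
move=> n0 Su; have [ST Sge0] := possemidefmx_gram S.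
split=> [|u u0]; first by rewrite /gram_mx linearZ /= ST.
rewrite -scalemxAr -scalemxAl mxE mulr_gt0 ?invr_gt0 ?ltr0n// lt_neqAle Sge0 andbT.
rewrite eq_sym; apply: contra_neq u0 => u0.
have uS : u^T *m S = 0.
  by apply: gram_row_eq0; rewrite trmx_mul trmxK !mulmxA in u0 *.
apply: trmx_inj; rewrite trmx0 -(mulmxK Su u^T).
by rewrite !mulmxA uS !mul0mx.
Qed.

Lemma innovation_posdef d d0 (B : 'M[R]_(d0, d)) (R0 : 'M[R]_d0) (p : 'M[R]_d) :
  posdefmx R0 -> possemidefmx p -> posdefmx (B *m p *m B^T + R0).
Proof.
move=> [R0T R0pos] /(possemidefmx_congr B)[pT p0].
split=> [|u u0]; first by rewrite linearD /= pT R0T.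
by rewrite mulmxDr mulmxDl mxE ltr_wpDl ?p0 ?R0pos.
Qed.

(** Even for a singular [p] the update loses no direction, as [R0] is definite. *)
Lemma Ahat_unit d d0 (B : 'M[R]_(d0, d)) (R0 : 'M[R]_d0) (p : 'M[R]_d) :
  posdefmx R0 -> possemidefmx p -> Ahat B R0 p \in unitmx.
Proof.
move=> R0pos ppos; have /posdefmx_unit Mu := innovation_posdef B R0pos ppos.
rewrite unitmxE unitfE; apply/negP => /det0P[v v0].
rewrite /Ahat mulmxBr mulmx1 mulmxA => /eqP; rewrite subr_eq0 => /eqP vE.
(* a left null vector of [Ahat] is [w *m B] for a left null vector [w] of [R0] *)
pose w := v *m gain B R0 p.
have wM : w *m (B *m p *m B^T + R0) = w *m (B *m p *m B^T).
  rewrite {1}/w /gain !mulmxA mulmxKV// -/w.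
  by rewrite [in LHS]vE.
have wR0 : w *m R0 = 0.
  by apply: (addrI (w *m (B *m p *m B^T))); rewrite -mulmxDr wM addr0.
have w0 : w = 0 by rewrite -(mulmxK (posdefmx_unit R0pos) w) wR0 mul0mx.
by move: v0; rewrite vE -/w w0 mul0mx eqxx.
Qed.

End definite_matrices.

(** * Wishart kernels *)

Section map_kernel.
Context {d1 d2 d3} {S1 : measurableType d1} {S2 : measurableType d2}
  {S3 : measurableType d3} {R : realType}.
Variables (Q : probability S2 R) (phi : S1 * S2 -> S3).
Hypothesis mphi : measurable_fun setT phi.

Let mphi_pair x : measurable_fun setT (fun y => phi (x, y)).
Proof.
have mx : measurable_fun setT (fun y : S2 => (x, y)) by exact/measurable_fun_pair.
exact: (measurableT_comp mphi mx).
Qed.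

Definition map_kernel : S1 -> {measure set S3 -> \bar R} :=
  fun x => image_prob Q (mphi_pair x).

Let measurable_map_kernel U : measurable U ->
  measurable_fun setT (map_kernel ^~ U).
Proof.
move=> mU; have mphiU := measurable_preimageT mphi mU.
have := measurable_fun_xsection Q mphiU; congr (measurable_fun setT _).
apply/funext => x /=; rewrite /map_kernel /=; congr (Q _).
by apply/seteqP; split=> y; rewrite /xsection /= inE.
Qed.

HB.instance Definition _ :=
  isKernel.Build _ _ S1 S3 R (map_kernel) measurable_map_kernel.

Let map_kernel_prob x : map_kernel x setT = 1%E.
Proof. exact: probability_setT. Qed.

HB.instance Definition _ :=
  Kernel_isProbability.Build _ _ S1 S3 R (map_kernel) map_kernel_prob.

End map_kernel.

Section wishart.
Context {R : realType}.

Lemma measurable_fun_gram_mx dd (T : measurableType dd) d n (f : T -> 'M[R]_(d, n)) :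
  measurable_fun setT f -> measurable_fun setT (fun w => gram_mx (f w)).
Proof.
move=> mf; apply: measurable_fun_scalemx; first exact: measurable_cst.
by apply: measurable_fun_mulmx => //; exact: measurable_fun_trmx.
Qed.

Lemma measurable_affine d n k (z : 'M[R]_(d, n)) (L : 'M[R]_(d, k)) :
  measurable_fun setT (fun G : 'M[R]_(k, n) => z + L *m G).
Proof.
by apply: measurable_fun_mxD; [exact: measurable_cst|exact: measurable_mulmxr].
Qed.

(** [gram_orbit] turns one [z] into the other by a rotation, which the Gaussian
    matrix absorbs and the Gram matrix does not see. *)
Lemma gauss_gram_orbit d n k (z1 z2 : 'M[R]_(d, n)) (L : 'M[R]_(d, k))
    (A : set 'M[R]_d) :
  z1 *m z1^T = z2 *m z2^T -> measurable A ->
  gauss k n [set G | A (gram_mx (z1 + L *m G))] =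
  gauss k n [set G | A (gram_mx (z2 + L *m G))].
Proof.
move=> /gram_orbit[ O [ OO inv <-]] mA.
have mB (z : 'M[R]_(d, n)) : measurable [set G : 'M[R]_(k, n) | A (gram_mx (z + L *m G))].
  apply: (measurable_preimageT (f := fun G => gram_mx (z + L *m G))) => //.
  by apply: measurable_fun_gram_mx; exact: measurable_affine.
rewrite -[RHS]inv//; congr (gauss k n _); apply/seteqP; split=> G /=;
  rewrite mulmxA -mulmxDl /gram_mx trmx_mul mulmxA;
  by rewrite -(mulmxA _ O) OO mulmx1.
Qed.

Lemma scaled_wishart_gauss d n k (z : 'M[R]_(d, n)) (L : 'M[R]_(d, k))
    (S Sigma : 'M[R]_d) (mu : set 'M[R]_d -> \bar R) :
  z *m z^T = S -> L *m L^T = Sigma ->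
  (forall A, measurable A ->
     mu A = gauss k n [set G | A (gram_mx (z + L *m G))]) ->
  scaled_wishart_law n S Sigma mu.
Proof.
move=> zS LSigma muE.
have mh : measurable_fun setT
    (fun G : 'M[R]_(k, n) => (z + L *m G) *m (z + L *m G)^T).
  apply: measurable_fun_mulmx; first exact: measurable_affine.
  by apply: measurable_fun_trmx; exact: measurable_affine.
have mL : measurable_fun setT (fun G : 'M[R]_(k, n) => L *m G).
  exact: measurable_mulmxr.
exists (image_prob (gauss k n) mh); last by move=> C mC; rewrite muE.
exists z, _, _, (gauss k n), (random_variable_of (gauss k n) mL).
have colL (G : 'M[R]_(k, n)) j : col j (L *m G) = L *m col j G.
  by apply/colP => i; rewrite !mxE; apply: eq_bigr => l _; rewrite mxE.
have mcolL (C : set 'cV[R]_d) : measurable C ->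
    measurable [set G : 'cV[R]_k | C (L *m G)].
  exact: (measurable_preimageT (measurable_mulmxr L)).
have colE j (C : set 'cV[R]_d) : measurable C ->
    gauss k n [set G | C (col j (L *m G))] = gauss k 1 [set G | C (L *m G)].
  move=> mC; rewrite -(gauss_column j (mcolL C mC)); congr (gauss k n _).
  by apply/seteqP; split=> G /=; rewrite colL.
split=> //.
- apply: independent_of_rectangles => C mC.
  transitivity (gauss k n [set G | forall j, [set x | C j (L *m x)] (col j G)]).
    congr (gauss k n _); apply/seteqP; split=> [G CG j|G CG j _] /=.
      by rewrite -colL; exact: CG.
    by rewrite colL; exact: CG.
  have mD j : measurable [set x : 'cV[R]_k | C j (L *m x)] := mcolL _ (mC j).
  rewrite (@gauss_columns R k n _ mD); apply: eq_bigr => j _.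
  exact: (esym (colE j (C j) (mC j))).
- by move=> j; rewrite -LSigma; apply: gauss_gaussian_law => C; exact: colE.
Qed.

Section wishart_kernel.
Variables (d n k : nat) (z : 'M[R]_d -> 'M[R]_(d, n)) (L : 'M[R]_d -> 'M[R]_(d, k)).
Hypotheses (mz : measurable_fun setT z) (mL : measurable_fun setT L).

Let measurable_wishart_map : measurable_fun setT
  (fun x : 'M[R]_d * 'M[R]_(k, n) => gram_mx (z x.1 + L x.1 *m x.2)).
Proof.
apply: measurable_fun_gram_mx; apply: measurable_fun_mxD.
  by apply: (measurableT_comp mz); exact: measurable_fst.
apply: measurable_fun_mulmx; last exact: measurable_snd.
by apply: (measurableT_comp mL); exact: measurable_fst.
Qed.

Definition wishart_kernel : R.-pker 'M[R]_d ~> 'M[R]_d :=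
  map_kernel (gauss k n) measurable_wishart_map.

Lemma wishart_kernelE S A : wishart_kernel S A =
  gauss k n [set G | A (gram_mx (z S + L S *m G))].
Proof. by []. Qed.

End wishart_kernel.

End wishart.

(** * The filter in contrast coordinates *)

Section contrast_recursion.
Context {R : realType} (d d0 N : nat).
Variables (A : 'M[R]_d) (B : 'M[R]_(d0, d)) (R0 : 'M[R]_d0).
Variable U : 'M[R]_(N.+1, N).
Hypotheses (U1 : (const_mx 1 : 'rV[R]_N.+1) *m U = 0) (UTU : U^T *m U = 1%:M)
  (UUT : U *m U^T = 1%:M - N.+1%:R^-1 *: const_mx 1).

Definition contrast_update (S : 'M[R]_(d, N)) (e : 'M[R]_(d0, N)) : 'M[R]_(d, N) :=
  Ahat B R0 (gram_mx S) *m S - gain B R0 (gram_mx S) *m e.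

Definition contrast_predict (S e : 'M[R]_(d, N)) : 'M[R]_(d, N) := A *m S + e.

(** The observation, being common to all particles, is killed by [U]. *)
Lemma contrast_updateE (y : 'cV[R]_d0) (v : 'I_N.+1 -> 'cV[R]_d0) (x : ensemble R d N) :
  ensemble_mx (enkf_update B R0 y v x) *m U =
  contrast_update (ensemble_mx x *m U) (ensemble_mx v *m U).
Proof.
rewrite /contrast_update -(sample_cov_gram x UTU UUT).
set K := gain B R0 (sample_cov x).
have -> : ensemble_mx (enkf_update B R0 y v x) =
    ensemble_mx x + K *m (y *m const_mx 1 - (B *m ensemble_mx x + ensemble_mx v)).
  apply/matrixP => i j; rewrite /enkf_update -/K !mxE; congr (_ + _).
  apply: eq_bigr => l _; rewrite !mxE big_ord1 mxE mulr1; congr (_ * (_ - (_ + _))).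
  by apply: eq_bigr => l' _; rewrite mxE.
rewrite /Ahat -/K mulmxDl -mulmxA mulmxBl mulmxDl -(mulmxA y) U1 mulmx0 sub0r.
rewrite mulmxN mulmxDr opprD mulmxBl mul1mx addrA -!mulmxA.
by [].
Qed.

Lemma contrast_predictE (x w : ensemble R d N) :
  ensemble_mx (fun i => A *m x i + w i) *m U =
  contrast_predict (ensemble_mx x *m U) (ensemble_mx w *m U).
Proof.
rewrite /contrast_predict mulmxA -mulmxDl; congr (_ *m _).
apply/matrixP => i j; rewrite !mxE; congr (_ + _).
by apply: eq_bigr => l _; rewrite mxE.
Qed.

Lemma measurable_gain dd (T : measurableType dd) (f : T -> 'M[R]_d) :
  measurable_fun setT f -> measurable_fun setT (fun w => gain B R0 (f w)).
Proof.
move=> mf; apply: measurable_fun_mulmx.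
  by apply: measurable_fun_mulmx => //; exact: measurable_cst.
apply: measurable_fun_invmx; apply: measurable_fun_mxD; last exact: measurable_cst.
apply: measurable_fun_mulmx; last exact: measurable_cst.
by apply: measurable_fun_mulmx => //; exact: measurable_cst.
Qed.

Lemma measurable_Ahat dd (T : measurableType dd) (f : T -> 'M[R]_d) :
  measurable_fun setT f -> measurable_fun setT (fun w => Ahat B R0 (f w)).
Proof.
move=> mf; apply: measurable_fun_mxB; first exact: measurable_cst.
apply: measurable_fun_mulmx; last exact: measurable_cst.
exact: measurable_gain.
Qed.

Lemma measurable_contrast_update :
  measurable_fun setT (fun x : 'M[R]_(d, N) * 'M[R]_(d0, N) => contrast_update x.1 x.2).
Proof.
have mg : measurable_fun setT
    (fun x : 'M[R]_(d, N) * 'M[R]_(d0, N) => gram_mx x.1).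
  by apply: measurable_fun_gram_mx; exact: measurable_fst.
apply: measurable_fun_mxB; apply: measurable_fun_mulmx.
- exact: measurable_Ahat.
- exact: measurable_fst.
- exact: measurable_gain.
- exact: measurable_snd.
Qed.

Lemma measurable_contrast_predict :
  measurable_fun setT (fun x : 'M[R]_(d, N) * 'M[R]_(d, N) => contrast_predict x.1 x.2).
Proof.
apply: measurable_fun_mxD; last exact: measurable_snd.
by apply: (measurableT_comp (measurable_mulmxr A)); exact: measurable_fst.
Qed.

End contrast_recursion.

(** * One step of the filter *)

Section one_step.
Context {disp} {T : measurableType disp} {R : realType} (P : probability T R).
Variables (I : Type) (F : I -> set (set T)) (N : nat) (iota : nat -> 'I_N.+1 -> I).
Hypothesis FsigmaT : forall a, F a setT.
Hypothesis FI : forall a, setI_closed (F a).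
Hypothesis Fmeasurable : forall a, F a `<=` measurable.
Hypothesis iota_inj : forall b i b' i', iota b i = iota b' i' -> (b, i) = (b', i').
Hypothesis indep : mutually_independent P F.

(** Fresh Gaussian noises enter the contrasts as a Gaussian matrix independent of
    the past, whatever their common mean. *)
Lemma fresh_noise_step K d m k (V : 'I_N.+1 -> T -> 'cV[R]_m) (mean : 'cV[R]_m)
    (L : 'M[R]_(m, k)) (U : 'M[R]_(N.+1, N)) (S : past_type F iota K -> 'M[R]_(d, N))
    (f : 'M[R]_(d, N) -> 'M[R]_(m, N) -> 'M[R]_(d, N))
    (D : set T) (E : set 'M[R]_(d, N)) :
  (const_mx 1 : 'rV[R]_N.+1) *m U = 0 ->
  (forall k' (A : set 'M[R]_(k', N)), measurable A ->
     gauss k' N.+1 [set G | A (G *m U)] = gauss k' N A) ->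
  (forall i, F (iota K i) = g_sigma_algebra_preimage (V i)) ->
  (forall i C, measurable C -> P (V i @^-1` C) = gauss k 1 [set G | C (mean + L *m G)]) ->
  measurable_fun setT S ->
  measurable_fun setT (fun x : 'M[R]_(d, N) * 'M[R]_(m, N) => f x.1 x.2) ->
  <<s past_rectangle F iota K >> D -> measurable E ->
  P (D `&` [set w | E (f (S w) (ensemble_mx (V^~ w) *m U))]) =
  (\int[P]_(w in D) gauss k N [set G | E (f (S w) (L *m G))])%E.
Proof.
move=> U1 UG FV lawV mS mf sD mE.
have mV i : measurable_fun setT (V i).
  move=> _ C mC; rewrite setTI; apply: (Fmeasurable (a := iota K i)).
  by rewrite FV; exists C; rewrite ?setTI.
have mX : measurable_fun setT (fun w => ensemble_mx (V^~ w) : 'M[R]_(m, N.+1)).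
  apply/measurable_fun_mxP => i j; under eq_fun do rewrite mxE.
  exact: (proj1 (measurable_fun_mxP _) (mV j)).
pose shifted (G : 'M[R]_(k, N.+1)) := mean *m const_mx 1 + L *m G.
have msh : measurable_fun setT shifted by exact: measurable_affine.
pose Q := image_prob (gauss k N.+1) msh.
have joint D' B : <<s past_rectangle F iota K >> D' -> measurable B ->
    P (D' `&` (fun w => ensemble_mx (V^~ w)) @^-1` B) = (P D' * Q B)%E.
  move=> sD' mB.
  apply: (columns_law (V := V) (L := L) (mean := mean)) => //.
    exact: (past_measurable Fmeasurable sD').
  move=> C mC.
  apply: (past_indep FsigmaT FI Fmeasurable iota_inj indep (K := K) sD') => i.
  by rewrite FV; exists (C i); rewrite ?setTI.
pose E' := [set x : 'M[R]_(d, N) * 'M[R]_(m, N.+1) | E (f x.1 (x.2 *m U))].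
have mE' : measurable E'.
  have mg : measurable_fun setT (fun x : 'M[R]_(d, N) * 'M[R]_(m, N.+1) => (x.1, x.2 *m U)).
    apply/measurable_fun_pair => /=; first exact: measurable_fst.
    by apply: (measurableT_comp (measurable_mulmxl U)); exact: measurable_snd.
  exact: (measurable_preimageT (measurableT_comp mf mg)).
rewrite -[LHS]/(P (D `&` [set w | E' (S w, ensemble_mx (V^~ w))])).
rewrite (past_freeze Fmeasurable mS mX joint sD mE').
apply: eq_integral => w _.
have mA : measurable [set G : 'M[R]_(k, N) | E (f (S w) (L *m G))].
  have mg : measurable_fun setT (fun G : 'M[R]_(k, N) => (S w, L *m G)).
    apply/measurable_fun_pair; [exact: measurable_cst|exact: measurable_mulmxr].
  exact: (measurable_preimageT (measurableT_comp mf mg)).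
rewrite -(UG k _ mA); congr (gauss k N.+1 _).
apply/seteqP; split=> G /=;
  by rewrite /E' /shifted /= mulmxDl -!mulmxA U1 mulmx0 add0r.
Qed.

End one_step.

(** * The Markov chain of sample covariances *)

(** The order in which the particles use their noises: first their initial values,
    then alternately a sensor noise and a signal noise. *)
Definition batch_index (N b : nat) (i : 'I_N.+1) : noise_index N :=
  if b is c.+1 then
    if odd c then ParticleSignalNoise c./2.+1 i else ParticleSensorNoise c./2 i
  else ParticleInit i.

Lemma batch_index_inj N b (i : 'I_N.+1) b' i' :
  batch_index b i = batch_index b' i' -> (b, i) = (b', i').
Proof.
case: b b' => [|b] [|b'] //=; do ?[by case: ifP]; first by case=> ->.
have half_inj : odd b = odd b' -> b./2 = b'./2 -> b = b'.
  by move=> ob hb; rewrite -(odd_double_half b) ob hb odd_double_half.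
by case: ifP => ob; case: ifP => ob' // -[hb ->]; rewrite (half_inj _ hb) ?ob ?ob'.
Qed.

Section preimage_sigma_algebra.
Context {d d'} {T : measurableType d} {T' : measurableType d'}.
Variable X : T -> T'.

Lemma g_sigma_algebra_preimageT : g_sigma_algebra_preimage X setT.
Proof. by exists setT => //; rewrite setTI preimage_setT. Qed.

Lemma g_sigma_algebra_preimageI : setI_closed (g_sigma_algebra_preimage X).
Proof.
move=> _ _ [A mA <-] [B mB <-]; exists (A `&` B); first exact: measurableI.
by rewrite !setTI preimage_setI.
Qed.

Lemma g_sigma_algebra_preimage_measurable :
  measurable_fun setT X -> g_sigma_algebra_preimage X `<=` measurable.
Proof. by move=> mX _ [A mA <-]; exact: mX. Qed.

End preimage_sigma_algebra.

Lemma alternate_even U (a b : nat -> U) n : alternate a b n.*2 = a n.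
Proof. by rewrite /alternate odd_double doubleK. Qed.

Lemma alternate_odd U (a b : nat -> U) n : alternate a b n.*2.+1 = b n.
Proof. by rewrite /alternate /= odd_double uphalf_double. Qed.

Lemma parity_cases k : (exists n, k = n.*2) \/ (exists n, k = n.*2.+1).
Proof.
by rewrite -[k]odd_double_half; case: (odd k); [right|left]; exists k./2.
Qed.

Lemma measurable_singular_gram (R : realType) d n :
  measurable [set S : 'M[R]_(d, n) | ~ (S *m S^T \in unitmx)].
Proof.
rewrite [X in measurable X](_ : _ =
    (fun S : 'M[R]_(d, n) => \det (S *m S^T)) @^-1` [set 0]).
  apply: measurable_preimageT => //; apply: measurable_fun_det.
  apply: measurable_fun_mulmx; first exact: measurable_id.
  by apply: measurable_fun_trmx; exact: measurable_id.
apply/seteqP; split=> S /=; rewrite unitmxE unitfE.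
  by move=> /negP; rewrite negbK => /eqP.
by move=> ->; rewrite eqxx.
Qed.

Theorem theorem5p4 (R : realType) (d d0 N : nat)
    (disp : measure_display) (T : measurableType disp) (P : probability T R)
    (A : 'M[R]_d) (B : 'M[R]_(d0, d))
    (Rw : 'M[R]_d) (R0 : 'M[R]_d0) (P0 : 'M[R]_d) (mean0 : 'cV[R]_d)
    (X0 : {RV P >-> 'cV[R]_d})
    (W : nat -> {RV P >-> 'cV[R]_d})
    (V : nat -> {RV P >-> 'cV[R]_d0})
    (xi0 : 'I_N.+1 -> {RV P >-> 'cV[R]_d})
    (cW : nat -> 'I_N.+1 -> {RV P >-> 'cV[R]_d})
    (cV : nat -> 'I_N.+1 -> {RV P >-> 'cV[R]_d0}) :
  (0 < d)%N -> (0 < d0)%N -> (d < N.+1)%N ->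
  posdefmx Rw -> posdefmx R0 -> posdefmx P0 ->
  gaussian_law mean0 P0 (pushforward P X0) ->
  (forall n, gaussian_law 0 Rw (pushforward P (W n))) ->
  (forall n, gaussian_law 0 R0 (pushforward P (V n))) ->
  (forall i (C : set 'cV[R]_d), measurable C ->
     P (xi0 i @^-1` C) = P (X0 @^-1` C)) ->
  (forall n i, gaussian_law 0 Rw (pushforward P (cW n i))) ->
  (forall n i, gaussian_law 0 R0 (pushforward P (cV n i))) ->
  mutually_independent P
    (noise_sigma X0 (fun n => W n) (fun n => V n) (fun i => xi0 i)
       (fun n i => cW n i) (fun n i => cV n i)) ->
  let Y (w : T) (n : nat) :=
    observation A B (X0 w) (fun k => W k w) (fun k => V k w) n in
  let xi (n : nat) (w : T) :=
    enkf A B R0 (Y w) (fun i => xi0 i w) (fun k i => cW k i w)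
      (fun k i => cV k i w) n in
  let xihat (n : nat) (w : T) :=
    enkf_hat A B R0 (Y w) (fun i => xi0 i w) (fun k i => cW k i w)
      (fun k i => cV k i w) n in
  let p (n : nat) (w : T) := sample_cov (xi n w) in
  let phat (n : nat) (w : T) := sample_cov (xihat n w) in
  [/\ {ae P, forall w, forall n, posdefmx (p n w) /\ posdefmx (phat n w)},
      scaled_wishart_law N 0 P0 (pushforward P (p 0%N)) &
      exists update predict : R.-pker 'M[R]_d ~> 'M[R]_d,
        [/\ forall S : 'M[R]_d, possemidefmx S ->
              scaled_wishart_law N
                (N%:R *: (Ahat B R0 S *m S *m (Ahat B R0 S)^T))
                (Rhat B R0 S) (update S),
            forall S : 'M[R]_d, possemidefmx S ->
              scaled_wishart_law N (N%:R *: (A *m S *m A^T)) Rw (predict S) &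
            markov_chain P (alternate p phat)
              (alternate (fun=> update) (fun=> predict))]].
Proof.
move=> d_gt0 d0_gt0; rewrite ltnS => dN Rwpos R0pos P0pos X0law Wlaw Vlaw
  xi0law cWlaw cVlaw indep Y xi xihat p phat.
have N_gt0 : (0 < N)%N by exact: leq_trans dN.
have NR0 : N%:R != 0 :> R by rewrite pnatr_eq0 -lt0n.
have [U [U1 UTU UUT UG]] := helmert_exists (R := R) N.
have [kP [LP LPE]] : exists k (L : 'M[R]_(d, k)), L *m L^T = P0.
  by have [k [L [? [? [? [? []]]]]]] := X0law; exists k, L.
have [kw [Lw LwE]] : exists k (L : 'M[R]_(d, k)), L *m L^T = Rw.
  by have [k [L [? [? [? [? []]]]]]] := cWlaw 0%N ord0; exists k, L.
have [kv [Lv LvE]] : exists k (L : 'M[R]_(d0, k)), L *m L^T = R0.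
  by have [k [L [? [? [? [? []]]]]]] := cVlaw 0%N ord0; exists k, L.
have lawP i C : measurable C ->
    P (xi0 i @^-1` C) = gauss kP 1 [set G | C (mean0 + LP *m G)].
  by move=> mC; rewrite xi0law//; exact: (gaussian_law_gauss X0law LPE mC).
have lawW n i C : measurable C ->
    P (cW n i @^-1` C) = gauss kw 1 [set G | C (0 + Lw *m G)].
  by move=> mC; exact: (gaussian_law_gauss (cWlaw n i) LwE mC).
have lawV n i C : measurable C ->
    P (cV n i @^-1` C) = gauss kv 1 [set G | C (0 + Lv *m G)].
  by move=> mC; exact: (gaussian_law_gauss (cVlaw n i) LvE mC).
set F := noise_sigma _ _ _ _ _ _ in indep.
have FT a : F a setT by case: a => *; exact: g_sigma_algebra_preimageT.
have FI a : setI_closed (F a) by case: a => *; exact: g_sigma_algebra_preimageI.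
have Fm a : F a `<=` measurable.
  by case: a => *; apply: g_sigma_algebra_preimage_measurable.
pose iota := @batch_index N.
have iota_inj b i b' i' : iota b i = iota b' i' -> (b, i) = (b', i').
  exact: batch_index_inj.
have FiotaV n i : F (iota n.*2.+1 i) = g_sigma_algebra_preimage (cV n i).
  by rewrite /iota /= odd_double doubleK.
have FiotaW n i : F (iota n.*2.+2 i) = g_sigma_algebra_preimage (cW n.+1 i).
  by rewrite /iota /= odd_double uphalf_double.
pose past := past_type F iota.
(* [S] and [Sh] form an autonomous recursion, free of the observations, and [p]
   and [phat] are their Gram matrices *)
pose S n w := ensemble_mx (xi n w) *m U.
pose Sh n w := ensemble_mx (xihat n w) *m U.
have ShE n w : Sh n w =
    contrast_update B R0 (S n w) (ensemble_mx (fun i => cV n i w) *m U).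
  exact: contrast_updateE.
have SE n w : S n.+1 w =
    contrast_predict A (Sh n w) (ensemble_mx (fun i => cW n.+1 i w) *m U).
  exact: contrast_predictE.
have pE n w : p n w = gram_mx (S n w) by exact: sample_cov_gram.
have phatE n w : phat n w = gram_mx (Sh n w) by exact: sample_cov_gram.
have mnoise K b m (Z : 'I_N.+1 -> T -> 'cV[R]_m) : (b < K)%N ->
    (forall i, F (iota b i) = g_sigma_algebra_preimage (Z i)) ->
    measurable_fun setT (fun w : past K => ensemble_mx (fun i => Z i w) *m U).
  move=> bK FZ; have mZ i : measurable_fun setT (Z i : past K -> 'cV[R]_m).
    move=> _ C mC; rewrite setTI; apply: sub_sigma_algebra.
    apply: (past_batch FT bK (i := i)).
    by rewrite FZ; exists C; rewrite ?setTI.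
  have mens : measurable_fun setT
      (fun w : past K => ensemble_mx (fun i => Z i w) : 'M[R]_(m, N.+1)).
    apply/measurable_fun_mxP => i j; under eq_fun do rewrite mxE.
    exact: (proj1 (measurable_fun_mxP _) (mZ j)).
  exact: (measurableT_comp (measurable_mulmxl U) mens).
have mhat n K : measurable_fun setT (S n : past K -> _) -> (n.*2.+1 < K)%N ->
    measurable_fun setT (Sh n : past K -> _).
  move=> mSn nK.
  have -> : Sh n = (fun x => contrast_update B R0 x.1 x.2) \o
      (fun w => (S n w, ensemble_mx (fun i => cV n i w) *m U)).
    by apply/funext => w; exact: ShE.
  apply: (measurableT_comp (measurable_contrast_update B R0)).
  by apply/measurable_fun_pair => //; exact: (mnoise K n.*2.+1).
have mpred n K : measurable_fun setT (Sh n : past K -> _) -> (n.*2.+2 < K)%N ->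
    measurable_fun setT (S n.+1 : past K -> _).
  move=> mSn nK.
  have -> : S n.+1 = (fun x => contrast_predict A x.1 x.2) \o
      (fun w => (Sh n w, ensemble_mx (fun i => cW n.+1 i w) *m U)).
    by apply/funext => w; exact: SE.
  apply: (measurableT_comp (measurable_contrast_predict A)).
  by apply/measurable_fun_pair => //; exact: (mnoise K n.*2.+2).
have mS n : forall K, (n.*2 < K)%N -> measurable_fun setT (S n : past K -> _).
  elim: n => [|n IHn] K nK; first exact: (mnoise K 0%N).
  have nK' : (n.*2.+2 < K)%N by move: nK; rewrite doubleS.
  apply: mpred => //; apply: mhat; last exact: ltnW.
  by apply: IHn; exact: ltnW (ltnW nK').
have mSh n K : (n.*2.+1 < K)%N -> measurable_fun setT (Sh n : past K -> _).
  by move=> nK; apply: mhat => //; apply: mS; exact: ltnW.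
have fromT K d' (Q : measurableType d') (f : T -> Q) :
    measurable_fun setT (f : past K -> Q) -> measurable_fun setT f.
  move=> mf _ C mC; exact: (past_measurable Fm (mf measurableT C mC)).
have mST n : measurable_fun setT (S n) by exact: (fromT n.*2.+1 _ _ _ (mS _ _ (ltnSn _))).
have mShT n : measurable_fun setT (Sh n) by exact: (fromT n.*2.+2 _ _ _ (mSh _ _ (ltnSn _))).
have init E : measurable E -> P (S 0%N @^-1` E) = gauss kP N [set G | E (LP *m G)].
  move=> mE.
  have := fresh_noise_step FT FI Fm iota_inj indep (K := 0) (S := fun=> 0 : 'M[R]_(d, N))
    (f := fun _ e => e) (D := setT) (E := E) U1 UG (fun i => erefl) lawP
    (measurable_cst _) measurable_snd.
  rewrite setTI => -> //; last exact: sub_sigma_algebra (past_rectangleT _ _ _).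
  rewrite integral_cst//.
  exact: etrans (congr1 (mule _) (probability_setT P)) (mule1 _).
have step_hat n D E : <<s past_rectangle F iota n.*2.+1 >> D -> measurable E ->
    P (D `&` Sh n @^-1` E) =
    (\int[P]_(w in D) gauss kv N [set G | E (contrast_update B R0 (S n w) (Lv *m G))])%E.
  move=> sD mE.
  rewrite -(fresh_noise_step FT FI Fm iota_inj indep U1 UG (FiotaV n) (lawV n)
    (mS n _ (ltnSn _)) (measurable_contrast_update B R0) sD mE).
  by congr (P (_ `&` _)); apply/seteqP; split=> w /=; rewrite ShE.
have step_pred n D E : <<s past_rectangle F iota n.*2.+2 >> D -> measurable E ->
    P (D `&` S n.+1 @^-1` E) =
    (\int[P]_(w in D) gauss kw N [set G | E (contrast_predict A (Sh n w) (Lw *m G))])%E.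
  move=> sD mE.
  rewrite -(fresh_noise_step FT FI Fm iota_inj indep U1 UG (FiotaW n) (lawW n.+1)
    (mSh n _ (ltnSn _)) (measurable_contrast_predict A) sD mE).
  by congr (P (_ `&` _)); apply/seteqP; split=> w /=; rewrite SE.
(* the noises of the initialisation and of the prediction have definite covariance:
   they can move the contrasts to any matrix, hence to one of full row rank *)
pose bad := [set M : 'M[R]_(d, N) | ~ (M *m M^T \in unitmx)].
have mbad : measurable bad by exact: measurable_singular_gram.
pose full : 'M[R]_(d, N) := pid_mx d.
have full_unit : full *m full^T \in unitmx.
  by rewrite /full tr_pid_mx mul_pid_mx minnn (minn_idPr dN) pid_mx_1 unitmx1.
have reach k (L : 'M[R]_(d, k)) Sigma (z : 'M[R]_(d, N)) :
    L *m L^T = Sigma -> posdefmx Sigma -> exists G, z + L *m G = full.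
  move=> LSigma /posdefmx_unit Su; exists (L^T *m (invmx Sigma *m (full - z))).
  by rewrite mulmxA LSigma mulKVmx// addrC subrK.
have S_bad n : P (S n.+1 @^-1` bad) = 0%E.
  rewrite -[X in P X]setTI step_pred//; last exact: sub_sigma_algebra (past_rectangleT _ _ _).
  apply: integral0_eq => w _.
  have [G0 G0E] := reach _ _ _ (A *m Sh n w) LwE Rwpos.
  by apply: (gauss_gram_unit (G0 := G0)); rewrite G0E.
have S0_bad : P (S 0%N @^-1` bad) = 0%E.
  rewrite init//.
  have [G0 G0E] := reach _ _ _ 0 LPE P0pos.
  transitivity (gauss kP N [set G | ~ ((0 + LP *m G) *m (0 + LP *m G)^T \in unitmx)]).
    by congr (gauss kP N _); apply/seteqP; split=> G /=; rewrite add0r.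
  by apply: (gauss_gram_unit (G0 := G0)); rewrite G0E.
have S_bad0 n : P (S n @^-1` bad) = 0%E by case: n.
(* the noise of the update may be degenerate, but at the value zero it leaves the
   full rank of the contrasts unchanged *)
have Sh_bad n : P (Sh n @^-1` bad) = 0%E.
  pose D := S n @^-1` ~` bad.
  have sD : <<s past_rectangle F iota n.*2.+1 >> D.
    have := mS n n.*2.+1 (ltnSn _) measurableT _ (measurableC mbad).
    by rewrite setTI.
  have D0 : P (D `&` Sh n @^-1` bad) = 0%E.
    rewrite step_hat//; apply: integral0_eq => w /= Dw.
    have good : S n w *m (S n w)^T \in unitmx by apply: contrapT.
    have Au := Ahat_unit B R0pos (possemidefmx_gram_mx (S n w)).
    set K := gain B R0 (gram_mx (S n w)).
    set z := Ahat B R0 (gram_mx (S n w)) *m S n w.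
    pose L : 'M[R]_(d, kv) := - (K *m Lv).
    transitivity (gauss kv N [set G | ~ ((z + L *m G) *m (z + L *m G)^T \in unitmx)]).
      congr (gauss kv N _); apply/seteqP; split=> G /=;
        by rewrite /contrast_update -/K -/z /L mulNmx mulmxA.
    apply: (gauss_gram_unit (G0 := 0)); rewrite mulmx0 addr0 /z.
    by rewrite trmx_mul mulmxA -(mulmxA _ (S n w)) !unitmx_mul unitmx_tr Au good.
  have mSb : measurable (S n @^-1` bad) := measurable_preimageT (mST n) mbad.
  have mShb : measurable (Sh n @^-1` bad) := measurable_preimageT (mShT n) mbad.
  have mDSh : measurable (D `&` Sh n @^-1` bad).
    by apply: measurableI => //; exact: measurable_preimageT (mST n) (measurableC mbad).
  apply: (subset_measure0 (B := S n @^-1` bad `|` (D `&` Sh n @^-1` bad))) => //.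
  - exact: measurableU.
  - by move=> w Shw; have [?|?] := pselect (bad (S n w)); [left|right].
  - exact: etrans (measureU0 mSb mDSh D0) (S_bad0 n).
split.
- have nullN (E : set T) : measurable E -> P E = 0%E -> {ae P, forall w, ~ E w}.
    by move=> mE PE; exists E; split=> // w /=; rewrite notK.
  apply/ae_foralln => n.
  have /nullN/(_ (S_bad0 n)) S_ae : measurable (S n @^-1` bad).
    exact: measurable_preimageT (mST n) mbad.
  have /nullN/(_ (Sh_bad n)) Sh_ae : measurable (Sh n @^-1` bad).
    exact: measurable_preimageT (mShT n) mbad.
  move: S_ae Sh_ae; apply: filterS2 => w /contrapT Sw /contrapT Shw.
  by rewrite pE phatE; split; exact: posdefmx_gram_mx.
- apply: (scaled_wishart_gauss (z := 0) (L := LP)) => //; first by rewrite mul0mx.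
  move=> C mC.
  have mE : measurable [set M : 'M[R]_(d, N) | C (gram_mx M)].
    apply: (measurable_preimageT (f := @gram_mx R d N)) => //.
    by apply: measurable_fun_gram_mx; exact: measurable_id.
  transitivity (P (S 0%N @^-1` [set M | C (gram_mx M)])).
    by congr (P _); apply/seteqP; split=> w /=; rewrite pE.
  rewrite init//; congr (gauss kP N _).
  by apply/seteqP; split=> G /=; rewrite add0r.
(* measurable choices of [z] with [z z'] prescribed *)
pose zu (M : 'M[R]_d) : 'M[R]_(d, N) :=
  cholesky N (N%:R *: (Ahat B R0 M *m M *m (Ahat B R0 M)^T)).
pose Lu (M : 'M[R]_d) : 'M[R]_(d, kv) := - (gain B R0 M *m Lv).
pose zp (M : 'M[R]_d) : 'M[R]_(d, N) := cholesky N (N%:R *: (A *m M *m A^T)).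
have mid := @measurable_id _ 'M[R]_d setT.
have mzu : measurable_fun setT zu.
  apply: measurable_cholesky; apply: measurable_fun_scalemx; first exact: measurable_cst.
  have mA := measurable_Ahat B R0 mid.
  apply: measurable_fun_mulmx; last exact: measurable_fun_trmx.
  exact: measurable_fun_mulmx.
have mLu : measurable_fun setT Lu.
  apply: measurable_fun_mxN; apply: measurable_fun_mulmx; last exact: measurable_cst.
  exact: measurable_gain.
have mzp : measurable_fun setT zp.
  apply: measurable_cholesky; apply: measurable_fun_scalemx; first exact: measurable_cst.
  apply: measurable_fun_mulmx; last exact: measurable_cst.
  exact: measurable_mulmxr.
have zuE M : possemidefmx M -> zu M *m (zu M)^T =
    N%:R *: (Ahat B R0 M *m M *m (Ahat B R0 M)^T).
  move=> Mpsd; apply: cholesky_gram => //.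
  by apply: possemidefmx_scale; [exact: ler0n|exact: possemidefmx_congr].
have zpE M : possemidefmx M -> zp M *m (zp M)^T = N%:R *: (A *m M *m A^T).
  move=> Mpsd; apply: cholesky_gram => //.
  by apply: possemidefmx_scale; [exact: ler0n|exact: possemidefmx_congr].
exists (wishart_kernel mzu mLu), (wishart_kernel mzp (@measurable_cst _ _ 'M[R]_d _ setT Lw)).
have gramE (C : 'M[R]_d) (M : 'M[R]_(d, N)) :
    (C *m M) *m (C *m M)^T = N%:R *: (C *m gram_mx M *m C^T).
  rewrite /gram_mx -scalemxAr -scalemxAl scalerA divff// scale1r.
  by rewrite trmx_mul !mulmxA.
have mgram C : measurable C -> measurable [set M : 'M[R]_(d, N) | C (gram_mx M)].
  move=> mC; apply: (measurable_preimageT (f := @gram_mx R d N)) => //.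
  by apply: measurable_fun_gram_mx; exact: measurable_id.
split.
- move=> M Mpsd.
  have LuE : Lu M *m (Lu M)^T = Rhat B R0 M.
    by rewrite /Lu linearN /= mulmxN mulNmx opprK trmx_mul mulmxA -(mulmxA _ Lv) LvE.
  exact: (scaled_wishart_gauss (zuE M Mpsd) LuE (fun C _ => wishart_kernelE mzu mLu M C)).
- move=> M Mpsd.
  exact: (scaled_wishart_gauss (zpE M Mpsd) LwE (fun C _ => wishart_kernelE mzp _ M C)).
have mp n K : (n.*2 < K)%N -> measurable_fun setT (p n : past K -> _).
  move=> nK; rewrite (_ : p n = (fun w => gram_mx (S n w))); last exact/funext.
  by apply: measurable_fun_gram_mx; exact: mS.
have mphat n K : (n.*2.+1 < K)%N -> measurable_fun setT (phat n : past K -> _).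
  move=> nK; rewrite (_ : phat n = (fun w => gram_mx (Sh n w))); last exact/funext.
  by apply: measurable_fun_gram_mx; exact: mSh.
have mZ k K : (k < K)%N -> measurable_fun setT (alternate p phat k : past K -> _).
  have [[n ->]|[n ->]] := parity_cases k; first by rewrite alternate_even; exact: mp.
  by rewrite alternate_odd; exact: mphat.
split=> [k|k D C hD mC]; first exact: (fromT k.+1 _ _ _ (mZ k _ (ltnSn _))).
have sD : <<s past_rectangle F iota k.+1 >> D.
  apply: smallest_sub hD; first exact: smallest_sigma_algebra.
  move=> _ [j /= jk [E mE <-]].
  exact: (mZ j k.+1 jk measurableT E mE).
have [[n kE]|[n kE]] := parity_cases k; subst k.
- rewrite !alternate_odd !alternate_even.
  transitivity (P (D `&` Sh n @^-1` [set M | C (gram_mx M)])).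
    by congr (P (_ `&` _)); apply/seteqP; split=> w /=; rewrite phatE.
  rewrite (step_hat _ _ _ sD (mgram _ mC)); apply: eq_integral => w _.
  rewrite wishart_kernelE pE.
  rewrite -(gauss_gram_orbit (z1 := Ahat B R0 (gram_mx (S n w)) *m S n w))//; last first.
    by rewrite gramE zuE//; exact: possemidefmx_gram_mx.
  congr (gauss kv N _); apply/seteqP; split=> G /=;
    by rewrite /contrast_update /Lu mulNmx mulmxA.
- rewrite -doubleS !alternate_even !alternate_odd.
  transitivity (P (D `&` S n.+1 @^-1` [set M | C (gram_mx M)])).
    by congr (P (_ `&` _)); apply/seteqP; split=> w /=; rewrite pE.
  rewrite (step_pred _ _ _ sD (mgram _ mC)); apply: eq_integral => w _.
  rewrite wishart_kernelE phatE -(gauss_gram_orbit (z1 := A *m Sh n w))//.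
  by rewrite gramE zpE//; exact: possemidefmx_gram_mx.
Qed.
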